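(* For each positive integer $n$, $$r_4(n)=16\widehat{\sigma}(n/2)+8\widehat{\sigma}(n),$$ $$\delta_4(n)=\widetilde{\sigma}(2n+1),$$ $$r_8(n)=16(-1)^{n-1}\widetilde{\sigma}_3(n),$$ $$8\delta_8(n)=\widetilde{\sigma}_3(n+1)-\widetilde{\sigma}_3(2(n+1)).$$
   Context: For $s,n\in\mathbb{N}$ (positive integers), $\widetilde{\sigma}_s(n)=\sum_{d\mid n}(-1)^{d-1}d^s$ and $\widehat{\sigma}_s(n)=\sum_{d\mid n}(-1)^{\frac nd-1}d^s$; write $\widetilde{\sigma}=\widetilde{\sigma}_1$, $\widehat{\sigma}=\widehat{\sigma}_1$, and set $\widetilde{\sigma}_s(n)=\widehat{\sigma}_s(n)=0$ if $n$ is not a positive integer. The numbers $r_s(n)$ and $\delta_s(n)$ are defined by $$\Big(\sum_{n=-\infty}^\infty q^{n^2}\Big)^s=\sum_{n=0}^\infty r_s(n)q^n,\qquad \Big(\sum_{n=0}^\infty q^{n(n+1)/2}\Big)^s=\sum_{n=0}^\infty\delta_s(n)q^n\qquad(|q|<1),$$ so $r_s(n)$ is the number of representations of $n$ as a sum of $s$ squares (of integers, ordered), and $\delta_s(n)$ is the number of representations of $n$ as an ordered sum of $s$ triangular numbers $T_k=k(k+1)/2$, $k\ge0$. *)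

(* Defs.v *)
From Stdlib Require Export Reals ZArith QArith List.
From Coquelicot Require Export Coquelicot.
From Stdlib Require Import Lia Lra ClassicalEpsilon.
Open Scope R_scope.

Definition divisors (n : nat) : list nat :=
  filter (fun d => Nat.eqb (Nat.modulo n d) 0) (List.seq 1 n).

Definition sum_divisors (f : nat -> Z) (n : nat) : Z :=
  fold_right Z.add 0%Z (map f (divisors n)).

(* Extension of an arithmetic function by 0 outside the positive integers. *)
Definition extend_by_0 (f : nat -> Z) (x : Q) : Z :=
  let y := Qred x in
  if (Pos.eqb (Qden y) 1 && Z.ltb 0 (Qnum y))%bool
  then f (Z.to_nat (Qnum y)) else 0%Z.

Definition sigma_tilde (s : nat) : Q -> Z :=
  extend_by_0 (sum_divisors (fun d =>
    (-1) ^ Z.of_nat (d - 1) * Z.of_nat d ^ Z.of_nat s)%Z).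

Definition sigma_hat (s : nat) : Q -> Z :=
  extend_by_0 (fun n => sum_divisors (fun d =>
    (-1) ^ Z.of_nat (Nat.div n d - 1) * Z.of_nat d ^ Z.of_nat s)%Z n).

Definition bilateral_Series (a : Z -> R) : R :=
  Series (fun n => a (Z.of_nat n)) + Series (fun n => a (- Z.of_nat (S n))%Z).

Definition phi (q : R) : R := bilateral_Series (fun n => q ^ Z.to_nat (n * n)).

Definition psi (q : R) : R := Series (fun n => q ^ Nat.div (n * (n + 1)) 2).

Definition is_expansion (f : R -> R) (a : nat -> R) : Prop :=
  forall q, Rabs q < 1 -> is_pseries a q (f q).

Lemma is_expansion_radius f a q :
  is_expansion f a -> Rabs q < 1 -> Rbar_lt (Rabs q) (CV_radius a).
Proof.
intros H Hq.
apply Rbar_not_le_lt; intros Hle.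
set (y := (Rabs q + 1) / 2).
assert (Hq0 := Rabs_pos q).
assert (Hy : Rabs y = y) by (apply Rabs_pos_eq; unfold y; lra).
apply (CV_disk_outside a y).
- apply Rbar_le_lt_trans with (1 := Hle). rewrite Hy. simpl. unfold y; lra.
- apply ex_series_lim_0. exists (f y). apply is_pseries_R, H.
  rewrite Hy; unfold y; lra.
Qed.

Lemma is_expansion_unique f a b n :
  is_expansion f a -> is_expansion f b -> a n = b n.
Proof.
intros Ha Hb.
assert (H0 : Rabs 0 < 1) by (rewrite Rabs_R0; lra).
apply PSeries_ext_recip.
- rewrite <- Rabs_R0. now apply (is_expansion_radius f).
- rewrite <- Rabs_R0. now apply (is_expansion_radius f).
- exists (mkposreal 1 Rlt_0_1). intros x Hx.
  assert (Hx1 : Rabs x < 1).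
  { change (Rabs (x - 0) < 1) in Hx. now rewrite Rminus_0_r in Hx. }
  rewrite (is_pseries_unique _ _ _ (Ha x Hx1)).
  now rewrite (is_pseries_unique _ _ _ (Hb x Hx1)).
Qed.

Lemma ex_expansion_pow f s :
  (exists a, is_expansion f a) -> exists a, is_expansion (fun q => f q ^ s) a.
Proof.
intros [a Ha]; induction s as [|s [b Hb]].
- exists (fun n => match n with O => 1 | S _ => 0 end).
  intros q _. apply is_pseries_R. simpl.
  apply (is_series_decr_1 (K := R_AbsRing) (V := R_NormedModule)).
  apply (is_series_ext (fun _ => 0)).
  { intros n; simpl; ring. }
  replace (plus _ _) with 0 by (unfold plus, opp; simpl; ring).
  apply (filterlim_ext (fun _ => 0)).
  { intros n. rewrite sum_n_const. ring. }
  apply filterlim_const.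
- exists (PS_mult a b). intros q Hq. simpl.
  apply is_pseries_mult.
  + now apply Ha.
  + now apply Hb.
  + now apply (is_expansion_radius f).
  + now apply (is_expansion_radius (fun q => f q ^ s)).
Qed.

Lemma ex_expansion_lacunary (e : nat -> nat) :
  (forall n, (e n < e (S n))%nat) ->
  exists a, is_expansion (fun q => Series (fun n => q ^ e n)) a.
Proof.
intros He.
assert (Hmono : forall m n, (m < n)%nat -> (e m < e n)%nat).
{ intros m n; induction 1 as [|n Hn IH]; [apply He|].
  specialize (He n); lia. }
assert (Hge : forall n, (n <= e n)%nat).
{ induction n as [|n IH]; [lia|]. specialize (He n); lia. }
set (a := fun k => if List.existsb (fun n => Nat.eqb (e n) k) (List.seq 0 (S k))
                   then 1 else 0).
assert (a1 : forall n, a (e n) = 1).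
{ intros n; unfold a. rewrite (proj2 (List.existsb_exists _ _)); [easy|].
  exists n; split; [apply List.in_seq; specialize (Hge n); lia|].
  apply Nat.eqb_refl. }
assert (a0 : forall k, (forall n, e n <> k) -> a k = 0).
{ intros k Hk; unfold a.
  destruct (List.existsb _ _) eqn:E; [|easy].
  apply List.existsb_exists in E. destruct E as [n [_ Hn]].
  now apply Nat.eqb_eq in Hn; elim (Hk n). }
assert (aB : forall k, Rabs (a k) <= 1).
{ intros k; unfold a. destruct (List.existsb _ _);
  [rewrite Rabs_R1|rewrite Rabs_R0]; lra. }
exists a; intros q Hq. apply is_pseries_R.
assert (Hex : ex_series (fun k => a k * q ^ k)).
{ apply (ex_series_le (K := R_AbsRing) (V := R_CompleteNormedModule) _
           (fun k => Rabs q ^ k)).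
  - intros k. change (Rabs (a k * q ^ k) <= Rabs q ^ k).
    rewrite Rabs_mult, <- RPow_abs.
    assert (H := pow_le (Rabs q) k (Rabs_pos q)). specialize (aB k). nra.
  - apply ex_series_geom. now rewrite Rabs_Rabsolu. }
destruct Hex as [l Hl].
assert (S0 : forall u : nat -> R, @eq R (sum_n u 0) (u O)).
{ intros u; apply sum_O. }
assert (SS : forall (u : nat -> R) n,
  @eq R (sum_n u (S n)) (sum_n u n + u (S n))).
{ intros u n; exact (@sum_Sn R_AbelianMonoid u n). }
assert (gap : forall m d, (forall n, (m < n <= m + d)%nat -> a n = 0) ->
   @eq R (sum_n (fun k => a k * q ^ k) (m + d))
         (sum_n (fun k => a k * q ^ k) m)).
{ intros m; induction d as [|d IH]; intros Hd.
  - now rewrite Nat.add_0_r.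
  - rewrite Nat.add_succ_r, SS, IH by (intros; apply Hd; lia).
    rewrite (Hd (S (m + d))) by lia. ring. }
assert (step : forall m n, (m < n)%nat ->
   (forall k, (m < k < n)%nat -> a k = 0) -> a n = 1 ->
   @eq R (sum_n (fun k => a k * q ^ k) n)
         (sum_n (fun k => a k * q ^ k) m + q ^ n)).
{ intros m n Hmn Hk Hn. destruct n as [|n]; [lia|].
  rewrite SS, Hn. replace (sum_n _ n) with (sum_n (fun k => a k * q ^ k) m).
  { ring. }
  replace n with (m + (n - m))%nat by lia.
  symmetry; apply gap. intros; apply Hk; lia. }
assert (psum : forall N, @eq R (sum_n (fun k => a k * q ^ k) (e N))
                               (sum_n (fun n => q ^ e n) N)).
{ induction N as [|N IH].
  - rewrite (S0 (fun n => q ^ e n)).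
    destruct (Nat.eq_dec (e O) 0) as [E|E].
    + rewrite E, S0, <- E, a1. ring.
    + rewrite (step O), S0, (a0 O); [ring| |lia| |apply a1].
      * intros [|n]; [lia|]. specialize (Hmono O (S n)); lia.
      * intros k Hk. apply a0. intros [|n]; [lia|].
        specialize (Hmono O (S n)); lia.
  - rewrite SS, <- IH. apply step; [apply He| |apply a1].
    intros k Hk. apply a0. intros i Hi.
    destruct (Nat.lt_trichotomy i N) as [H|[->|H]]; [|lia|].
    + apply Hmono in H; lia.
    + destruct (Nat.eq_dec i (S N)) as [->|]; [lia|].
      assert (S N < i)%nat as H' by lia. apply Hmono in H'; lia. }
replace (Series (fun n => q ^ e n)) with l; [exact Hl|].
symmetry; apply is_series_unique.
change (is_lim_seq (sum_n (fun n => q ^ e n)) (Finite l)).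
apply (is_lim_seq_ext (fun N => sum_n (fun k => a k * q ^ k) (e N))).
{ exact psum. }
apply (is_lim_seq_subseq (sum_n (fun k => a k * q ^ k))).
- intros P [N HN]. exists N. intros n Hn. apply HN. specialize (Hge n); lia.
- exact Hl.
Qed.

Lemma ex_expansion_phi : exists a, is_expansion phi a.
Proof.
destruct (ex_expansion_lacunary (fun n => n * n)%nat) as [a Ha]; [intros; lia|].
destruct (ex_expansion_lacunary (fun n => S n * S n)%nat) as [b Hb];
  [intros; lia|].
exists (PS_plus a b). intros q Hq. unfold phi, bilateral_Series.
apply (is_pseries_plus (K := R_AbsRing) (V := R_NormedModule)).
- rewrite (Series_ext _ (fun n => q ^ (n * n))); [now apply Ha|].
  intros n; f_equal; lia.
- rewrite (Series_ext _ (fun n => q ^ (S n * S n))); [now apply Hb|].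
  intros n; f_equal; lia.
Qed.

Lemma ex_expansion_psi : exists a, is_expansion psi a.
Proof.
apply (ex_expansion_lacunary (fun n => Nat.div (n * (n + 1)) 2)).
intros n. replace (S n * (S n + 1))%nat with (n * (n + 1) + (n + 1) * 2)%nat by lia.
rewrite Nat.div_add by lia. lia.
Qed.

(* [r s] and [delta s] are the coefficient sequences of the generating
   functions; [is_expansion_unique] shows that no actual choice is involved,
   and that the values [q] in the real interval (-1, 1) determine them. *)
Definition r (s : nat) : nat -> R :=
  proj1_sig (constructive_indefinite_description _
    (ex_expansion_pow phi s ex_expansion_phi)).

Definition delta (s : nat) : nat -> R :=
  proj1_sig (constructive_indefinite_description _
    (ex_expansion_pow psi s ex_expansion_psi)).

Lemma r_spec s : is_expansion (fun q => phi q ^ s) (r s).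
Proof. unfold r; now destruct constructive_indefinite_description. Qed.

Lemma delta_spec s : is_expansion (fun q => psi q ^ s) (delta s).
Proof. unfold delta; now destruct constructive_indefinite_description. Qed.

(* Main.v *)
Require Import Defs.
From Stdlib Require Import Reals ZArith QArith List Permutation Lia Lra.
From Stdlib Require Qcanon.

(** Everything is reduced to the theorem on two squares, r_2(n) = 4 X(n) with
    X(n) = sum of chi(d) over d | n, where chi is the nontrivial character
    modulo 4; a convolution identity of Liouville and relations between theta
    functions then lead from exponent 2 to 4 and 8.

    Two squares. If theta = sum of c_k q^k and D = q d/dq, then b = theta^2
    satisfies theta Db = 2 b D(theta), that is,
    sum over k of c_k (n - 3 k) b_(n-k) = 0, and this recurrence together with
    b_0 determines b ([square_recurrence_unique]).  So it suffices that
    1 + 4 sum X(n) q^n satisfies it too, which is a statement about the sum of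
    (d e - 2 i^2) chi(e) over the solutions of i^2 + d e = n.  That sum is
    evaluated in the manner of Liouville and Uspensky: after adding terms that
    are odd in i, the summand is (e - 2i)(d + i) chi(e), the solutions are split
    by the sign of e - 2i - d, and a reflection or a shift by d cancels each
    half ([sum_weight_negative_excess], [sum_weight_positive_excess]).  Only
    e - 2i = d is left, which forces n = (i + d)^2 and balances the terms
    k = n of the recurrence ([square_recurrence_two_squares]).

    Triangular numbers. Splitting n^2 by the parity of n gives
    phi(q) = phi(q^4) + 2 q psi(q^8).  Squaring, and comparing with the values
    of r_2, yields delta_2(n) = X(4n+1) ([delta_2]) and the identities
    phi(q)^2 = phi(q^2)^2 + 4 q psi(q^4)^2 ([phi_square]) and
    phi(q) psi(q^2) = psi(q)^2 ([phi_psi]).  Liouville's identity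
    ([liouville_identity]) evaluates, for even F, the sum of
    F(d - d') - F(d + d') over the solutions of d e + d' e' = 2m in odd positive
    integers.  With F(x) = cos(pi x / 2) on even x it squares X, giving delta_4;
    with F(x) = x^2 it squares the sum of divisors, giving delta_8.

    Squares. The identities above imply
    phi(q)^4 = phi(q^2)^4 + 16 q^2 psi(q^4)^4 + 8 q psi(q^2)^4 and
    phi(q)^8 = phi(-q^2)^8 + 16 q psi(q)^8 ([phi_fourth], [phi_eighth]).  They
    express r_4(n) and r_8(n) through delta_4, delta_8 and the values at n/2, so
    that the formulas follow by induction on n from the behaviour of the divisor
    sums under doubling. *)

Local Open Scope Z_scope.

Local Ltac div_lia := Z.to_euclidean_division_equations; lia.

(** * Finite sums over duplicate-free lists *)

Definition sumz {A : Type} (l : list A) (f : A -> Z) : Z :=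
  fold_right Z.add 0 (map f l).

Lemma sumz_ext {A} (l : list A) f g :
  (forall x, In x l -> f x = g x) -> sumz l f = sumz l g.
Proof.
unfold sumz; intros H; f_equal; now apply map_ext_in.
Qed.

Lemma sumz_app {A} (l1 l2 : list A) f :
  sumz (l1 ++ l2) f = sumz l1 f + sumz l2 f.
Proof. unfold sumz; induction l1 as [|x l IH]; simpl in *; lia. Qed.

Lemma sumz_flat_map {A B} (l : list A) (g : A -> list B) f :
  sumz (flat_map g l) f = sumz l (fun x => sumz (g x) f).
Proof.
induction l as [|x l IH]; [easy|].
simpl flat_map; rewrite sumz_app, IH; reflexivity.
Qed.

Lemma sumz_map {A B} (l : list A) (g : A -> B) f :
  sumz (map g l) f = sumz l (fun x => f (g x)).
Proof. unfold sumz; now rewrite map_map. Qed.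

Lemma sumz_list_prod {A B} (l1 : list A) (l2 : list B) f :
  sumz (list_prod l1 l2) f = sumz l1 (fun x => sumz l2 (fun y => f (x, y))).
Proof.
induction l1 as [|x l IH]; [easy|].
simpl list_prod; rewrite sumz_app, IH, sumz_map; reflexivity.
Qed.

Lemma sumz_add {A} (l : list A) f g :
  sumz l (fun x => f x + g x) = sumz l f + sumz l g.
Proof. unfold sumz; induction l as [|x l IH]; simpl in *; lia. Qed.

Lemma sumz_mul {A} (l : list A) c f :
  sumz l (fun x => c * f x) = c * sumz l f.
Proof. unfold sumz; induction l as [|x l IH]; simpl in *; lia. Qed.

Lemma sumz_sub {A} (l : list A) f g :
  sumz l (fun x => f x - g x) = sumz l f - sumz l g.
Proof. unfold sumz; induction l as [|x l IH]; simpl in *; lia. Qed.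

Lemma sumz_prod {A B} (l1 : list A) (l2 : list B) f g :
  sumz (list_prod l1 l2) (fun p => f (fst p) * g (snd p)) = sumz l1 f * sumz l2 g.
Proof.
rewrite sumz_list_prod, Z.mul_comm, <- sumz_mul.
apply sumz_ext; intros x _; simpl; rewrite sumz_mul; ring.
Qed.

Lemma sumz_0 {A} (l : list A) f :
  (forall x, In x l -> f x = 0) -> sumz l f = 0.
Proof.
intros H; rewrite (sumz_ext l f (fun _ => 0 * 0)) by (simpl; assumption).
now rewrite sumz_mul.
Qed.

Lemma sumz_filter {A} (p : A -> bool) (l : list A) f :
  sumz (filter p l) f = sumz l (fun x => if p x then f x else 0).
Proof.
unfold sumz; induction l as [|x l IH]; [easy|].
simpl; destruct (p x); simpl in *; lia.
Qed.

Lemma sumz_split {A} (p : A -> bool) (l : list A) f :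
  sumz l f = sumz (filter p l) f + sumz (filter (fun x => negb (p x)) l) f.
Proof.
rewrite !sumz_filter, <- sumz_add; apply sumz_ext; intros x _.
destruct (p x); simpl; lia.
Qed.

(** The form in which every reindexing below is done: [g] and [h] are mutually
    inverse on the entries of the two lists only. *)
Lemma sumz_bij {A B} (l1 : list A) (l2 : list B) f1 f2 g h :
  NoDup l1 -> NoDup l2 ->
  (forall x, In x l1 -> In (g x) l2 /\ h (g x) = x /\ f1 x = f2 (g x)) ->
  (forall y, In y l2 -> In (h y) l1 /\ g (h y) = y) ->
  sumz l1 f1 = sumz l2 f2.
Proof.
intros N1 N2 Hg Hh.
assert (P : Permutation (map g l1) l2).
{ apply NoDup_Permutation; [|assumption|].
  - apply NoDup_map_NoDup_ForallPairs; [|assumption].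
    intros x y Hx Hy E.
    rewrite <- (proj1 (proj2 (Hg x Hx))), E; apply (Hg y Hy).
  - intros y; rewrite in_map_iff; split.
    + intros [x [<- Hx]]; now apply Hg.
    + intros Hy; exists (h y); split; now apply Hh. }
transitivity (sumz (map g l1) f2).
- rewrite sumz_map; apply sumz_ext; intros x Hx; now apply Hg.
- clear - P; unfold sumz; induction P; simpl in *; lia.
Qed.

Lemma sumz_same {A} (l1 l2 : list A) f :
  NoDup l1 -> NoDup l2 -> (forall x, In x l1 <-> In x l2) ->
  sumz l1 f = sumz l2 f.
Proof.
intros N1 N2 H; apply (sumz_bij _ _ _ _ (fun x => x) (fun x => x)); trivial;
intros x Hx; repeat split; now apply H.
Qed.

Lemma sumz_odd {A} (l : list A) f g :
  NoDup l ->
  (forall x, In x l -> In (g x) l /\ g (g x) = x /\ f (g x) = - f x) ->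
  sumz l f = 0.
Proof.
intros N H.
assert (E : sumz l f = sumz l (fun x => -1 * f x)).
{ apply (sumz_bij _ _ _ _ g g); trivial; intros x Hx;
  destruct (H x Hx) as [H1 [H2 H3]]; repeat split; trivial; lia. }
rewrite sumz_mul in E; lia.
Qed.

(** Disjointness of the blocks is witnessed by a function [key] that recovers from
    an entry the block it belongs to. *)
Lemma NoDup_flat_map {A B} (l : list A) (g : A -> list B) (key : B -> A) :
  NoDup l -> (forall x, In x l -> NoDup (g x)) ->
  (forall x y, In x l -> In y (g x) -> key y = x) -> NoDup (flat_map g l).
Proof.
induction l as [|x l IH]; simpl; intros N Hg Hk; [constructor|].
inversion_clear N as [|? ? Hx N'].
apply NoDup_app.
- apply Hg; auto.
- apply IH; auto; intros; apply Hk; auto.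
- intros y Hy Hy'; apply in_flat_map in Hy'; destruct Hy' as [x' [Hx' Hy']].
  apply Hx; rewrite <- (Hk x y), (Hk x' y) by auto; assumption.
Qed.

Lemma NoDup_list_prod {A B} (l1 : list A) (l2 : list B) :
  NoDup l1 -> NoDup l2 -> NoDup (list_prod l1 l2).
Proof.
intros N1 N2; rewrite list_prod_as_flat_map.
apply NoDup_flat_map with (key := fst); trivial.
- intros x _; apply NoDup_map_NoDup_ForallPairs; trivial.
  intros a b _ _ E; now inversion E.
- intros x y _ Hy; apply in_map_iff in Hy; now destruct Hy as [b [<- _]].
Qed.

Definition zrange (a b : Z) : list Z :=
  map (fun k => a + Z.of_nat k) (seq 0 (Z.to_nat (b - a + 1))).

Lemma in_zrange a b x : In x (zrange a b) <-> a <= x <= b.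
Proof.
unfold zrange; rewrite in_map_iff; split.
- intros [k [<- Hk]]; apply in_seq in Hk; lia.
- intros H; exists (Z.to_nat (x - a)); rewrite in_seq; lia.
Qed.

Lemma NoDup_zrange a b : NoDup (zrange a b).
Proof.
apply FinFun.Injective_map_NoDup; [|apply seq_NoDup]. intros x y H; lia.
Qed.

(** Keeping the cofactor next to the divisor makes the substitutions of Liouville's
    method, which mix divisors and cofactors, maps between such lists. *)
Definition factorisations (n : Z) : list (Z * Z) :=
  filter (fun p => fst p * snd p =? n) (list_prod (zrange 1 n) (zrange 1 n)).

Lemma in_factorisations n d e :
  In (d, e) (factorisations n) <-> 1 <= d /\ 1 <= e /\ d * e = n.
Proof.
unfold factorisations; rewrite filter_In, in_prod_iff, !in_zrange; simpl.
rewrite Z.eqb_eq; split; [lia|]. intros [Hd [He H]]; repeat split; nia.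
Qed.

Lemma NoDup_factorisations n : NoDup (factorisations n).
Proof. apply NoDup_filter, NoDup_list_prod; apply NoDup_zrange. Qed.

Lemma sumz_factorisations_swap n f :
  sumz (factorisations n) f = sumz (factorisations n) (fun p => f (snd p, fst p)).
Proof.
apply (sumz_bij _ _ _ _ (fun p => (snd p, fst p)) (fun p => (snd p, fst p)));
try apply NoDup_factorisations; intros [d e]; simpl;
rewrite !in_factorisations; intuition lia.
Qed.

Definition antidiagonal (n : nat) : list (nat * nat) :=
  map (fun k => (k, (n - k)%nat)) (seq 0 (S n)).

Lemma in_antidiagonal n i j : In (i, j) (antidiagonal n) <-> (i + j = n)%nat.
Proof.
unfold antidiagonal; rewrite in_map_iff; split.
- intros [k [E Hk]]; apply in_seq in Hk; inversion E; lia.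
- intros H; exists i; rewrite in_seq; split; [f_equal|]; lia.
Qed.

Lemma NoDup_antidiagonal n : NoDup (antidiagonal n).
Proof.
apply FinFun.Injective_map_NoDup; [|apply seq_NoDup]. intros x y H.
now inversion H.
Qed.

Definition convolution (a b : nat -> Z) (n : nat) : Z :=
  sumz (antidiagonal n) (fun p => a (fst p) * b (snd p)).

(** * The quadratic character modulo 4 and an involution on i^2 + d e = n *)

(** The cancellations below treat separately the three signs of a linear form [w]. *)
Lemma sumz_trichotomy {A} (w : A -> Z) (l : list A) f :
  sumz l f = sumz (filter (fun x => 0 <? w x) l) f
             + sumz (filter (fun x => w x <? 0) l) f
             + sumz (filter (fun x => w x =? 0) l) f.
Proof.
rewrite !sumz_filter, <- !sumz_add; apply sumz_ext; intros x _.
destruct (Z.ltb_spec 0 (w x)), (Z.ltb_spec (w x) 0), (Z.eqb_spec (w x) 0); lia.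
Qed.

Definition chi (x : Z) : Z :=
  if x mod 4 =? 1 then 1 else if x mod 4 =? 3 then -1 else 0.

Lemma chi_cases x :
  x mod 4 = 1 /\ chi x = 1 \/ x mod 4 = 3 /\ chi x = -1
  \/ x mod 2 = 0 /\ chi x = 0.
Proof.
unfold chi; destruct (Z.eqb_spec (x mod 4) 1), (Z.eqb_spec (x mod 4) 3); div_lia.
Qed.

Lemma chi_opp x : chi (- x) = - chi x.
Proof. destruct (chi_cases x), (chi_cases (- x)); div_lia. Qed.

Lemma chi_shift4 x i : chi (x + 4 * i) = chi x.
Proof. destruct (chi_cases x), (chi_cases (x + 4 * i)); div_lia. Qed.

Lemma chi_mul x y : chi (x * y) = chi x * chi y.
Proof.
assert (E : forall a b, (a * b) mod 4 = ((a mod 4) * (b mod 4)) mod 4).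
{ intros; apply Zmult_mod. }
unfold chi; rewrite E.
assert (Hx := Z.mod_pos_bound x 4); assert (Hy := Z.mod_pos_bound y 4).
assert (Cx : x mod 4 = 0 \/ x mod 4 = 1 \/ x mod 4 = 2 \/ x mod 4 = 3) by div_lia.
assert (Cy : y mod 4 = 0 \/ y mod 4 = 1 \/ y mod 4 = 2 \/ y mod 4 = 3) by div_lia.
destruct Cx as [->|[->|[->| ->]]], Cy as [->|[->|[->| ->]]]; reflexivity.
Qed.

Definition square_plus_product (n : Z) : list (Z * (Z * Z)) :=
  flat_map (fun i => map (pair i) (factorisations (n - i * i))) (zrange (-n) n).

Lemma in_square_plus_product n i d e :
  In (i, (d, e)) (square_plus_product n) <->
  1 <= d /\ 1 <= e /\ i * i + d * e = n.
Proof.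
unfold square_plus_product; rewrite in_flat_map; split.
- intros [j [_ H]]; apply in_map_iff in H; destruct H as [[d' e'] [E H]].
  inversion E; subst; apply in_factorisations in H; lia.
- intros [Hd [He H]]; exists i; rewrite in_zrange, in_map_iff; split; [nia|].
  exists (d, e); rewrite in_factorisations; repeat split; lia.
Qed.

Lemma NoDup_square_plus_product n : NoDup (square_plus_product n).
Proof.
apply NoDup_flat_map with (key := fst); [apply NoDup_zrange| |].
- intros i _; apply FinFun.Injective_map_NoDup; [|apply NoDup_factorisations].
  intros x y E; now inversion E.
- intros i y _ Hy; apply in_map_iff in Hy; now destruct Hy as [p [<- _]].
Qed.

Lemma sum_square_plus_product_odd n f :
  (forall i d e, f (- i, (d, e)) = - f (i, (d, e))) ->
  sumz (square_plus_product n) f = 0.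
Proof.
intros H; apply sumz_odd with (g := fun x => (- fst x, snd x)).
- apply NoDup_square_plus_product.
- intros [i [d e]]; simpl; rewrite !in_square_plus_product, H.
  rewrite Z.opp_involutive; intuition lia.
Qed.

(** Its sign decides whether the shift of [i] by [d] keeps the triple
    positive, since (i + d)^2 + d (e - 2i - d) = i^2 + d e. *)
Definition excess (x : Z * (Z * Z)) : Z := let '(i, (d, e)) := x in e - 2 * i - d.

(** The average of this over i and -i is (d e - 2 i^2) chi(e), which is the
    quantity of interest; in this form the first factor changes sign under a
    reflection that fixes the other two. *)
Definition weight (x : Z * (Z * Z)) : Z :=
  let '(i, (d, e)) := x in (e - 2 * i) * (d + i) * chi e.

(** The identity (e - i)^2 + (d + 2i - e) e = i^2 + d e defines an involution of the
    triples with e - 2i < d; it fixes d + i and e and negates e - 2i. *)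
Lemma sum_weight_negative_excess n :
  sumz (filter (fun x => excess x <? 0) (square_plus_product n)) weight = 0.
Proof.
apply sumz_odd with
  (g := fun x => let '(i, (d, e)) := x in (e - i, (d + 2 * i - e, e))).
- apply NoDup_filter, NoDup_square_plus_product.
- intros [i [d e]]; unfold weight, excess.
  rewrite !filter_In, !in_square_plus_product, !Z.ltb_lt.
  intros [[Hd [He H]] L]; repeat split; try lia.
  f_equal; [lia|f_equal; lia].
Qed.

(** The shift i -> i + d, e -> e - 2i - d turns the weight into
    k = (d + e) i chi(e + 2i - d), summed over e + 2i - d > 0.  Exchanging d and e
    and negating i shows that k has the same sum over e + 2i - d < 0; and k is odd
    in i because chi has period 4, so its sum over all triples is zero. *)
Lemma sum_weight_positive_excess n :
  sumz (filter (fun x => 0 <? excess x) (square_plus_product n)) weight = 0.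
Proof.
set (k := fun x : Z * (Z * Z) =>
  let '(i, (d, e)) := x in (d + e) * i * chi (e + 2 * i - d)).
set (w := fun x : Z * (Z * Z) => let '(i, (d, e)) := x in e + 2 * i - d).
set (T := square_plus_product n).
assert (ND : NoDup T) by apply NoDup_square_plus_product.
transitivity (sumz (filter (fun x => 0 <? w x) T) k).
{ apply sumz_bij with
    (g := fun x => let '(i, (d, e)) := x in (i + d, (d, e - 2 * i - d)))
    (h := fun x => let '(i, (d, e)) := x in (i - d, (d, e + 2 * i - d)));
  try (now apply NoDup_filter);
  intros [i [d e]]; unfold T, k, w, weight, excess;
  rewrite !filter_In, !in_square_plus_product, !Z.ltb_lt;
  intros [[Hd [He H]] L]; repeat split; try lia; try (repeat f_equal; lia).
  replace (e - 2 * i - d + 2 * (i + d) - d) with e by ring; ring. }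
assert (E : sumz (filter (fun x => 0 <? w x) T) k
            = sumz (filter (fun x => w x <? 0) T) k).
{ apply sumz_bij with
    (g := fun x => let '(i, (d, e)) := x in (- i, (e, d)))
    (h := fun x => let '(i, (d, e)) := x in (- i, (e, d)));
  try (now apply NoDup_filter);
  intros [i [d e]]; unfold T, k, w;
  rewrite !filter_In, !in_square_plus_product, !Z.ltb_lt;
  intros [[Hd [He H]] L]; repeat split; try lia; try (repeat f_equal; lia).
  replace (d + 2 * - i - e) with (- (e + 2 * i - d)) by ring.
  rewrite chi_opp; ring. }
assert (E0 : sumz (filter (fun x => w x =? 0) T) k = 0).
{ apply sumz_0; intros [i [d e]]; unfold k, w.
  rewrite filter_In, Z.eqb_eq; intros [_ ->]; unfold chi; simpl; ring. }
assert (Z0 : sumz T k = 0).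
{ apply sum_square_plus_product_odd; intros i d e; unfold k.
  replace (e + 2 * i - d) with (e + 2 * - i - d + 4 * i) by ring.
  rewrite chi_shift4; ring. }
rewrite (sumz_trichotomy w) in Z0; lia.
Qed.

Lemma zrange_succ_r a b : a <= b + 1 -> zrange a (b + 1) = zrange a b ++ (b + 1) :: nil.
Proof.
intros H; unfold zrange.
replace (Z.to_nat (b + 1 - a + 1)) with (Z.to_nat (b - a + 1) + 1)%nat by lia.
rewrite seq_app, map_app; simpl; do 2 f_equal; lia.
Qed.

Lemma sumz_zrange_succ a b f :
  a <= b + 1 -> sumz (zrange a (b + 1)) f = sumz (zrange a b) f + f (b + 1).
Proof.
intros H; rewrite zrange_succ_r, sumz_app by lia.
unfold sumz; simpl; ring.
Qed.

(** The second sum is (2s-1) - (2s-3) + (2s-5) - ...; the first one is carried along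
    because it is the increment needed in the induction. *)
Lemma sum_chi s : 1 <= s ->
  sumz (zrange 1 (2 * s - 1)) chi = s mod 2 /\
  sumz (zrange 1 (2 * s - 1)) (fun d => (2 * s - d) * chi d) = s.
Proof.
intros Hs; replace s with (Z.of_nat (Z.to_nat (s - 1)) + 1) by lia.
induction (Z.to_nat (s - 1)) as [|k [IH1 IH2]]; [split; reflexivity|].
set (t := Z.of_nat k + 1) in *.
replace (Z.of_nat (S k) + 1) with (t + 1) by lia.
replace (2 * (t + 1) - 1) with (2 * t - 1 + 1 + 1) by ring.
rewrite !sumz_zrange_succ by lia.
rewrite (sumz_ext _ (fun d => (2 * (t + 1) - d) * chi d)
  (fun d => (2 * t - d) * chi d + 2 * chi d)) by (intros; ring).
rewrite sumz_add, sumz_mul, IH1, IH2.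
destruct (chi_cases (2 * t - 1 + 1)) as [C|[C|[_ ->]]]; try div_lia.
destruct (chi_cases (2 * t - 1 + 1 + 1)) as [[C ->]|[[C ->]|C]]; div_lia.
Qed.

(** On e - 2i = d one has n = (i + d)^2, and i + d = s is the positive root because
    2 (i + d) = d + e.  So the triples correspond to 0 < e < 2s, with weight
    s (2s - e) chi(e). *)
Lemma sum_weight_zero_excess_square n s : 1 <= s -> s * s = n ->
  sumz (filter (fun x => excess x =? 0) (square_plus_product n)) weight = n.
Proof.
intros Hs <-.
transitivity (sumz (zrange 1 (2 * s - 1)) (fun d => s * ((2 * s - d) * chi d))).
2: { now rewrite sumz_mul, (proj2 (sum_chi s Hs)). }
apply sumz_bij with (g := fun x => let '(i, (d, e)) := x in e)
  (h := fun e => (e - s, (2 * s - e, e))).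
- apply NoDup_filter, NoDup_square_plus_product.
- apply NoDup_zrange.
- intros [i [d e]]; unfold weight, excess.
  rewrite filter_In, in_square_plus_product, Z.eqb_eq, in_zrange.
  intros [[Hd [He H]] L].
  (* Both i + d and s are positive roots of n, as 2 (i + d) = d + e > 0. *)
  assert (i + d = s) by nia.
  repeat split; [lia|lia|repeat f_equal; lia|].
  replace (e - 2 * i) with (2 * s - e) by lia.
  replace (d + i) with s by lia; ring.
- intros e; rewrite in_zrange, filter_In, in_square_plus_product.
  unfold excess; rewrite Z.eqb_eq.
  intros H; repeat split; lia.
Qed.

Lemma sum_weight_zero_excess_nonsquare n : (forall s, s * s <> n) ->
  sumz (filter (fun x => excess x =? 0) (square_plus_product n)) weight = 0.
Proof.
intros Hn; apply sumz_0; intros [i [d e]]; unfold excess.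
rewrite filter_In, in_square_plus_product, Z.eqb_eq.
intros [[Hd [He H]] L]; elim (Hn (i + d)); rewrite <- H.
replace e with (2 * i + d) by lia; ring.
Qed.

Lemma sum_weight_boundary n :
  sumz (square_plus_product n)
    (fun x => let '(i, (d, e)) := x in (d * e - 2 * (i * i)) * chi e)
  = sumz (filter (fun x => excess x =? 0) (square_plus_product n)) weight.
Proof.
transitivity (sumz (square_plus_product n) weight).
- apply Z.sub_move_0_r; rewrite <- sumz_sub.
  apply sum_square_plus_product_odd; intros i d e; unfold weight; ring.
- now rewrite (sumz_trichotomy excess), sum_weight_negative_excess,
    sum_weight_positive_excess.
Qed.

(** * Sums of two squares *)

Definition chi_sum (n : Z) : Z := sumz (factorisations n) (fun p => chi (snd p)).

Definition theta_coef (k : nat) : Z :=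
  if Nat.eqb k 0 then 1 else if Nat.eqb (Nat.sqrt k * Nat.sqrt k) k then 2 else 0.

(** The theta coefficient of q^k counts these, which turns sums weighted by theta
    coefficients into sums over integers. *)
Definition integer_roots (k : Z) : list Z :=
  filter (fun j => j * j =? k) (zrange (- k) k).

Lemma in_integer_roots k j : In j (integer_roots k) <-> j * j = k.
Proof.
unfold integer_roots; rewrite filter_In, in_zrange, Z.eqb_eq; split; [lia|nia].
Qed.

Lemma NoDup_integer_roots k : NoDup (integer_roots k).
Proof. apply NoDup_filter, NoDup_zrange. Qed.

Lemma theta_coef_square s : (1 <= s)%nat -> theta_coef (s * s) = 2.
Proof.
intros Hs; unfold theta_coef; rewrite Nat.sqrt_square, Nat.eqb_refl.
destruct (Nat.eqb_spec (s * s) 0); [nia|easy].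
Qed.

Lemma theta_coef_cases k :
  k = 0%nat /\ theta_coef k = 1 \/
  (exists s, (1 <= s)%nat /\ k = (s * s)%nat /\ theta_coef k = 2) \/
  (forall s, s * s <> Z.of_nat k) /\ theta_coef k = 0.
Proof.
destruct (Nat.eq_dec k 0) as [->|H0]; [now left|right].
unfold theta_coef; destruct (Nat.eqb_spec k 0) as [|_]; [easy|].
destruct (Nat.eqb_spec (Nat.sqrt k * Nat.sqrt k) k) as [E|E].
- left; exists (Nat.sqrt k); repeat split; [nia|easy].
- right; split; [|easy]; intros s Hs; apply E.
  replace k with (Z.abs_nat s * Z.abs_nat s)%nat by nia.
  now rewrite Nat.sqrt_square.
Qed.

Lemma theta_coef_roots k :
  theta_coef k = sumz (integer_roots (Z.of_nat k)) (fun _ => 1).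
Proof.
destruct (theta_coef_cases k) as [[-> ->]|[[s [Hs [-> ->]]]|[H ->]]]; [easy| |].
- transitivity (sumz (Z.of_nat s :: - Z.of_nat s :: nil) (fun _ => 1)); [easy|].
  apply sumz_same.
  + repeat constructor; simpl; lia.
  + apply NoDup_integer_roots.
  + intros x; rewrite in_integer_roots; simpl; nia.
- symmetry; apply sumz_0; intros x Hx; apply in_integer_roots in Hx.
  now elim (H x).
Qed.

(** The n-th coefficient of c Db - 2 b Dc for the power series with coefficients
    [c] and [b], where D = q d/dq. *)
Definition square_recurrence (c b : nat -> Z) (n : nat) : Z :=
  sumz (antidiagonal n)
    (fun p => c (fst p) * ((Z.of_nat (snd p) - 2 * Z.of_nat (fst p)) * b (snd p))).

(** The term k = 0 of the recurrence is n b_n, all the others involve earlier values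
    of b. *)
Lemma square_recurrence_unique c a b : c 0%nat = 1 -> a 0%nat = b 0%nat ->
  (forall n, (1 <= n)%nat -> square_recurrence c a n = 0) ->
  (forall n, (1 <= n)%nat -> square_recurrence c b n = 0) ->
  forall n, a n = b n.
Proof.
intros Hc H0 Ha Hb n; induction n as [n IH] using lt_wf_ind.
destruct (Nat.eq_dec n 0) as [->|Hn]; [easy|].
assert (E : square_recurrence c a n - square_recurrence c b n = 0)
  by (rewrite Ha, Hb by lia; ring).
unfold square_recurrence in E; rewrite <- sumz_sub in E.
unfold antidiagonal in E; rewrite sumz_map in E.
change (seq 0 (S n)) with (0 :: seq 1 n)%nat in E.
change (sumz (0 :: seq 1 n)%nat ?f) with (f 0%nat + sumz (seq 1 n) f) in E.
rewrite sumz_0 in E.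
- cbn beta iota delta [fst snd] in E; rewrite Nat.sub_0_r, Hc in E; nia.
- intros k Hk; apply in_seq in Hk; simpl; rewrite IH by lia; ring.
Qed.

Definition triples (n : nat) : list (nat * (nat * nat)) :=
  flat_map (fun p => map (pair (fst p)) (antidiagonal (snd p))) (antidiagonal n).

Lemma in_triples n i j k : In (i, (j, k)) (triples n) <-> (i + j + k = n)%nat.
Proof.
unfold triples; rewrite in_flat_map; split.
- intros [[i' m] [H1 H2]]; apply in_map_iff in H2; destruct H2 as [[j' k'] [E H]].
  inversion E; subst; apply in_antidiagonal in H1, H; simpl in *; lia.
- intros H; exists (i, (j + k)%nat); rewrite in_antidiagonal, in_map_iff.
  split; [lia|]; exists (j, k); now rewrite in_antidiagonal.
Qed.

Lemma NoDup_triples n : NoDup (triples n).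
Proof.
apply NoDup_flat_map with
  (key := fun t => (fst t, (fst (snd t) + snd (snd t))%nat)).
- apply NoDup_antidiagonal.
- intros [i m] _; apply FinFun.Injective_map_NoDup; [|apply NoDup_antidiagonal].
  intros x y E; now inversion E.
- intros [i m] y _ Hy; apply in_map_iff in Hy; destruct Hy as [[j k] [<- H]].
  apply in_antidiagonal in H; simpl in *; now subst.
Qed.

(** Expanding b = c * c, the sum runs over i + j + k = n with the weight
    (j - i) + (k - i) against the symmetric product c_i c_j c_k; each of the two
    parts is negated by a transposition. *)
Lemma square_recurrence_square c n : square_recurrence c (convolution c c) n = 0.
Proof.
set (u := fun (w : nat * (nat * nat) -> Z) (t : nat * (nat * nat)) =>
  w t * (c (fst t) * c (fst (snd t)) * c (snd (snd t)))).
transitivity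
  (sumz (triples n) (u (fun t => Z.of_nat (fst (snd t)) - Z.of_nat (fst t))) +
   sumz (triples n) (u (fun t => Z.of_nat (snd (snd t)) - Z.of_nat (fst t)))).
- rewrite <- sumz_add; unfold triples; rewrite sumz_flat_map.
  apply sumz_ext; intros [k m] _; rewrite sumz_map; cbn [fst snd].
  unfold convolution; rewrite <- !sumz_mul; apply sumz_ext; intros [i j] H.
  apply in_antidiagonal in H; unfold u; cbn [fst snd] in *; rewrite <- H, Nat2Z.inj_add; ring.
- rewrite (sumz_odd _ _ (fun t => (fst (snd t), (fst t, snd (snd t))))).
  1: rewrite (sumz_odd _ _ (fun t => (snd (snd t), (fst (snd t), fst t)))); [easy| |].
  all: try apply NoDup_triples.
  all: intros [i [j k]]; unfold u; cbn [fst snd]; rewrite !in_triples;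
    intros H; repeat split; [lia|ring].
Qed.

Lemma sumz_theta_coef n h :
  sumz (antidiagonal n) (fun p => theta_coef (fst p) * h (fst p))
  = sumz (filter (fun j => j * j <=? Z.of_nat n)
            (zrange (- Z.of_nat n) (Z.of_nat n)))
      (fun j => h (Z.to_nat (j * j))).
Proof.
transitivity (sumz (flat_map (fun p => map (pair (fst p))
    (integer_roots (Z.of_nat (fst p)))) (antidiagonal n)) (fun x => h (fst x))).
- rewrite sumz_flat_map; apply sumz_ext; intros [k m] _; simpl.
  rewrite sumz_map, theta_coef_roots, Z.mul_comm, <- sumz_mul; simpl.
  apply sumz_ext; intros; ring.
- apply sumz_bij with (g := snd) (h := fun j => (Z.to_nat (j * j), j)).
  + apply NoDup_flat_map with (key := fun x => (fst x, (n - fst x)%nat)).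
    * apply NoDup_antidiagonal.
    * intros p _; apply FinFun.Injective_map_NoDup; [|apply NoDup_integer_roots].
      intros x y E; now inversion E.
    * intros [k m] y H Hy; apply in_map_iff in Hy; destruct Hy as [j [<- _]].
      apply in_antidiagonal in H; simpl; f_equal; lia.
  + apply NoDup_filter, NoDup_zrange.
  + intros [k j] H; apply in_flat_map in H; destruct H as [[k' m] [H1 H2]].
    apply in_map_iff in H2; destruct H2 as [j' [E H]]; inversion E; subst.
    apply in_antidiagonal in H1; apply in_integer_roots in H; simpl in *.
    rewrite filter_In, in_zrange, Z.leb_le, H, Nat2Z.id; repeat split; nia.
  + intros j; rewrite filter_In, in_zrange, Z.leb_le; intros [H1 H2].
    split; [|easy]; apply in_flat_map.
    exists (Z.to_nat (j * j), (n - Z.to_nat (j * j))%nat).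
    rewrite in_antidiagonal, in_map_iff; split; [lia|].
    exists j; rewrite in_integer_roots; simpl; split; [easy|nia].
Qed.

Definition two_squares (n : nat) : Z :=
  if Nat.eqb n 0 then 1 else 4 * chi_sum (Z.of_nat n).

(** Writing the theta coefficients as sums over the integers j with j^2 = k, the
    part j^2 < n is the sum over i^2 + d e = n evaluated above, because there
    n - 3 j^2 = d e - 2 j^2.  The part j^2 = n contributes -2n for each root; when
    n is a square this is -4n, which cancels 4 times the boundary sum n. *)
Lemma square_recurrence_two_squares n : (1 <= n)%nat ->
  square_recurrence theta_coef two_squares n = 0.
Proof.
intros Hn; set (N := Z.of_nat n).
transitivity (sumz (square_plus_product N)
    (fun x => let '(i, (d, e)) := x in (d * e - 2 * (i * i)) * chi e) * 4
  - 2 * N * theta_coef n).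
- transitivity (sumz (antidiagonal n) (fun p => theta_coef (fst p)
     * ((N - 3 * Z.of_nat (fst p)) * two_squares (n - fst p)))).
  { apply sumz_ext; intros [k m] H; apply in_antidiagonal in H; cbn [fst snd].
    replace (n - k)%nat with m by lia; unfold N; rewrite <- H, Nat2Z.inj_add; ring. }
  rewrite (sumz_theta_coef n
    (fun k => (N - 3 * Z.of_nat k) * two_squares (n - k))), theta_coef_roots.
  rewrite <- sumz_mul; unfold integer_roots, square_plus_product; fold N.
  rewrite sumz_flat_map, Z.mul_comm, <- sumz_mul, !sumz_filter, <- sumz_sub.
  apply sumz_ext; intros j Hj; apply in_zrange in Hj.
  rewrite sumz_map; unfold two_squares.
  destruct (Z.leb_spec (j * j) N) as [Hl|Hl].
  + destruct (Nat.eqb_spec (n - Z.to_nat (j * j)) 0) as [H|H].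
    * destruct (Z.eqb_spec (j * j) N) as [E|E]; [|lia].
      rewrite E, Z.sub_diag; change (factorisations 0) with (@nil (Z * Z)).
      unfold N; rewrite Nat2Z.id; change (sumz nil _) with 0; ring.
    * destruct (Z.eqb_spec (j * j) N) as [E|E]; [lia|].
      unfold chi_sum; rewrite Z.sub_0_r, Z.mul_assoc.
      rewrite (Z.mul_comm _ 4), <- Z.mul_assoc, <- sumz_mul; f_equal.
      replace (Z.of_nat (n - Z.to_nat (j * j))) with (N - j * j) by (unfold N in *; nia).
      apply sumz_ext; intros [d e] Hp; apply in_factorisations in Hp; cbn [fst snd].
      destruct Hp as [_ [_ Hp]]; rewrite Hp; rewrite Z2Nat.id by nia; ring.
  + destruct (Z.eqb_spec (j * j) N) as [E|E]; [lia|].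
    rewrite sumz_0; [easy|].
    intros [d e] Hp; apply in_factorisations in Hp; nia.
- rewrite sum_weight_boundary.
  destruct (theta_coef_cases n) as [[H _]|[[s [Hs [E ->]]]|[H ->]]]; [lia| |].
  + rewrite (sum_weight_zero_excess_square N (Z.of_nat s)); nia.
  + rewrite sum_weight_zero_excess_nonsquare; [ring|assumption].
Qed.

Lemma convolution_theta_coef n : convolution theta_coef theta_coef n = two_squares n.
Proof.
apply (square_recurrence_unique theta_coef); try easy.
- intros; apply square_recurrence_square.
- apply square_recurrence_two_squares.
Qed.

(** * Liouville's identity for pairs of odd factorisations *)

Lemma mul_positive a b : 1 <= a -> 1 <= b -> 1 <= a * b.
Proof. nia. Qed.

Lemma odd_mul d e : (d * e) mod 2 = 1 <-> d mod 2 = 1 /\ e mod 2 = 1.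
Proof.
rewrite Zmult_mod.
assert (Cd : d mod 2 = 0 \/ d mod 2 = 1) by div_lia.
assert (Ce : e mod 2 = 0 \/ e mod 2 = 1) by div_lia.
destruct Cd as [->| ->], Ce as [->| ->]; cbn; lia.
Qed.

(** The solutions ((d, e), (d', e')) of d e + d' e' = 2 (n + 1) in odd positive
    integers, grouped by the values d e = 2i + 1 and d' e' = 2j + 1. *)
Definition odd_quadruples (n : nat) : list ((Z * Z) * (Z * Z)) :=
  flat_map (fun p => list_prod (factorisations (2 * Z.of_nat (fst p) + 1))
                               (factorisations (2 * Z.of_nat (snd p) + 1)))
    (antidiagonal n).

Lemma in_odd_quadruples n d e d' e' :
  In ((d, e), (d', e')) (odd_quadruples n) <->
  (1 <= d /\ d mod 2 = 1) /\ (1 <= e /\ e mod 2 = 1) /\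
  (1 <= d' /\ d' mod 2 = 1) /\ (1 <= e' /\ e' mod 2 = 1) /\
  d * e + d' * e' = 2 * (Z.of_nat n + 1).
Proof.
unfold odd_quadruples; rewrite in_flat_map; split.
- intros [[i j] [H1 H2]]; apply in_antidiagonal in H1.
  apply in_prod_iff in H2; rewrite !in_factorisations in H2; cbn [fst snd] in H2.
  assert (A := proj1 (odd_mul d e)); assert (B := proj1 (odd_mul d' e')).
  destruct H2 as [[Hd [He H]] [Hd' [He' H']]].
  destruct A; [rewrite H; div_lia|]; destruct B; [rewrite H'; div_lia|].
  repeat split; trivial; lia.
- intros [[Hd Pd] [[He Pe] [[Hd' Pd'] [[He' Pe'] H]]]].
  assert (A := proj2 (odd_mul d e) (conj Pd Pe)).
  assert (B := proj2 (odd_mul d' e') (conj Pd' Pe')).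
  exists (Z.to_nat ((d * e) / 2), Z.to_nat ((d' * e') / 2)).
  rewrite in_antidiagonal, in_prod_iff, !in_factorisations; cbn [fst snd].
  assert (Pde := mul_positive d e Hd He).
  assert (Pde' := mul_positive d' e' Hd' He').
  repeat split; trivial; div_lia.
Qed.

Lemma NoDup_odd_quadruples n : NoDup (odd_quadruples n).
Proof.
apply NoDup_flat_map with (key := fun q : (Z * Z) * (Z * Z) =>
  let '((d, e), (d', e')) := q in
  (Z.to_nat ((d * e) / 2), Z.to_nat ((d' * e') / 2))).
- apply NoDup_antidiagonal.
- intros p _; apply NoDup_list_prod; apply NoDup_factorisations.
- intros [i j] [[d e] [d' e']] _ H.
  apply in_prod_iff in H; rewrite !in_factorisations in H; cbn [fst snd] in H.
  destruct H as [[_ [_ ->]] [_ [_ ->]]]; f_equal; div_lia.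
Qed.

Lemma sumz_odd_quadruples n f :
  sumz (odd_quadruples n) (fun q => f (fst q) * f (snd q))
  = sumz (antidiagonal n) (fun p =>
      sumz (factorisations (2 * Z.of_nat (fst p) + 1)) f *
      sumz (factorisations (2 * Z.of_nat (snd p) + 1)) f).
Proof.
unfold odd_quadruples; rewrite sumz_flat_map; apply sumz_ext; intros p _.
apply sumz_prod.
Qed.

(** Both sums in Liouville's identity are brought to this common list: it describes
    u e + x v = N after u = d - d', v = e + e' and after u = d + d', v = e - e'. *)
Definition mixed_quadruples (N : Z) : list ((Z * Z) * (Z * Z)) :=
  filter (fun q => let '((u, e), (x, v)) := q in
     (u * e + x * v =? N) && (u mod 2 =? 0) && (e mod 2 =? 1)
     && (x mod 2 =? 1) && (v mod 2 =? 0))%bool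
    (let I := zrange 1 N in list_prod (list_prod I I) (list_prod I I)).

Lemma in_mixed_quadruples N u e x v :
  In ((u, e), (x, v)) (mixed_quadruples N) <->
  (1 <= u /\ u mod 2 = 0) /\ (1 <= e /\ e mod 2 = 1) /\
  (1 <= x /\ x mod 2 = 1) /\ (1 <= v /\ v mod 2 = 0) /\ u * e + x * v = N.
Proof.
unfold mixed_quadruples; rewrite filter_In, !in_prod_iff, !in_zrange.
rewrite !Bool.andb_true_iff, !Z.eqb_eq; split; [intuition lia|].
intros [[Hu Pu] [[He Pe] [[Hx Px] [[Hv Pv] H]]]].
assert (u <= u * e /\ e <= u * e) by (clear - Hu He; nia).
assert (x <= x * v /\ v <= x * v) by (clear - Hx Hv; nia).
repeat split; trivial; lia.
Qed.

Lemma NoDup_mixed_quadruples N : NoDup (mixed_quadruples N).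
Proof. apply NoDup_filter; repeat apply NoDup_list_prod; apply NoDup_zrange. Qed.

Definition odd_cofactor (m : Z) : list (Z * Z) :=
  filter (fun p => snd p mod 2 =? 1) (factorisations m).

(** Each factorisation (d, e) with odd e, repeated d times: this counts the ways of
    writing 2d as an ordered sum of two positive odd numbers. *)
Definition marked (m : Z) : list ((Z * Z) * Z) :=
  flat_map (fun p => map (pair p) (zrange 1 (fst p))) (odd_cofactor m).

Lemma in_marked m d e k :
  In ((d, e), k) (marked m) <->
  1 <= d /\ 1 <= e /\ d * e = m /\ e mod 2 = 1 /\ 1 <= k <= d.
Proof.
unfold marked, odd_cofactor; rewrite in_flat_map; split.
- intros [[d' e'] [H1 H2]]; apply in_map_iff in H2; destruct H2 as [k' [E H]].
  inversion E; subst; apply in_zrange in H; apply filter_In in H1.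
  rewrite in_factorisations, Z.eqb_eq in H1; cbn [fst snd] in *; intuition lia.
- intros H; exists (d, e); rewrite filter_In, in_factorisations, Z.eqb_eq, in_map_iff.
  cbn [fst snd]; split; [intuition lia|].
  exists k; rewrite in_zrange; intuition lia.
Qed.

Lemma NoDup_marked m : NoDup (marked m).
Proof.
apply NoDup_flat_map with (key := fst).
- apply NoDup_filter, NoDup_factorisations.
- intros p _; apply FinFun.Injective_map_NoDup; [|apply NoDup_zrange].
  intros x y E; now inversion E.
- intros p y _ H; apply in_map_iff in H; now destruct H as [k [<- _]].
Qed.

Lemma sumz_marked m f :
  sumz (marked m) (fun t => f (fst t)) = sumz (odd_cofactor m) (fun p => fst p * f p).
Proof.
unfold marked; rewrite sumz_flat_map; apply sumz_ext; intros [d e] H.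
apply filter_In in H; rewrite in_factorisations in H; cbn [fst] in *.
rewrite sumz_map; cbn [fst].
rewrite (sumz_ext _ _ (fun _ => f (d, e) * 1)) by (intros; ring).
rewrite sumz_mul, Z.mul_comm; f_equal.
unfold sumz, zrange; rewrite map_map.
replace (Z.to_nat (d - 1 + 1)) with (Z.to_nat d) by lia.
rewrite <- (Z2Nat.id d) at 2 by lia.
generalize (Z.to_nat d) 0%nat; intros k; induction k as [|k IH]; [easy|].
intros s; simpl seq; cbn [map fold_right]; rewrite IH; lia.
Qed.

Section Liouville.

Variables (n : nat) (F : Z -> Z).
Hypothesis F_even : forall x, F (- x) = F x.

Let Q := odd_quadruples n.
Let m := Z.of_nat n + 1.

Local Ltac quad :=
  try apply NoDup_filter; try apply NoDup_odd_quadruples;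
  try apply NoDup_mixed_quadruples; try apply NoDup_marked.

(** For d = d' the equation reads d (e + e') = 2m, so (e + e') / 2 is a divisor of m
    with odd cofactor d, and e is one of the odd numbers below e + e'. *)
Lemma sum_difference_diagonal :
  sumz (filter (fun q => fst (fst q) - fst (snd q) =? 0) Q)
    (fun q => F (fst (fst q) - fst (snd q)))
  = sumz (odd_cofactor m) (fun p => fst p * F 0).
Proof.
rewrite <- (sumz_marked m (fun _ => F 0)).
apply sumz_bij with
  (g := fun q => let '((d, e), (d', e')) := q in (((e + e') / 2, d), (e + 1) / 2))
  (h := fun t => let '((d, e), k) := t in ((e, 2 * k - 1), (e, 2 * d - 2 * k + 1)));
quad; unfold Q, m.
- intros [[d e] [d' e']]; rewrite filter_In, in_odd_quadruples, Z.eqb_eq, in_marked.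
  cbn [fst snd]; intros [H E]; assert (d' = d) by lia; subst d'.
  rewrite Z.sub_diag.
  assert ((e + e') / 2 * d = Z.of_nat n + 1).
  { assert (X : 2 * ((e + e') / 2) = e + e') by div_lia.
    clear - X H; nia. }
  repeat split; try lia; try div_lia; f_equal; f_equal; div_lia.
- intros [[d e] k]; rewrite filter_In, in_odd_quadruples, Z.eqb_eq, in_marked.
  cbn [fst snd]; intros H; repeat split; try lia; try div_lia; f_equal; [f_equal|]; div_lia.
Qed.

(** As for d = d', with the roles of d and e exchanged. *)
Lemma sum_sum_diagonal :
  sumz (filter (fun q => snd (fst q) - snd (snd q) =? 0) Q)
    (fun q => F (fst (fst q) + fst (snd q)))
  = sumz (odd_cofactor m) (fun p => fst p * F (2 * fst p)).
Proof.
rewrite <- (sumz_marked m (fun p => F (2 * fst p))).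
apply sumz_bij with
  (g := fun q => let '((d, e), (d', e')) := q in (((d + d') / 2, e), (d + 1) / 2))
  (h := fun t => let '((d, e), k) := t in ((2 * k - 1, e), (2 * d - 2 * k + 1, e)));
quad; unfold Q, m.
- intros [[d e] [d' e']]; rewrite filter_In, in_odd_quadruples, Z.eqb_eq, in_marked.
  cbn [fst snd]; intros [H E]; assert (e' = e) by lia; subst e'.
  assert (X : 2 * ((d + d') / 2) = d + d') by div_lia.
  rewrite X.
  assert ((d + d') / 2 * e = Z.of_nat n + 1) by (clear - X H; nia).
  repeat split; try lia; try div_lia; f_equal; f_equal; div_lia.
- intros [[d e] k]; rewrite filter_In, in_odd_quadruples, Z.eqb_eq, in_marked.
  cbn [fst snd]; intros H; repeat split; try lia; try div_lia; f_equal; f_equal; div_lia.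
Qed.

(** d e + d' e' = (d - d') e + d' (e + e'). *)
Lemma sum_difference_positive :
  sumz (filter (fun q => 0 <? fst (fst q) - fst (snd q)) Q)
    (fun q => F (fst (fst q) - fst (snd q)))
  = sumz (filter (fun q => snd (fst q) <? snd (snd q)) (mixed_quadruples (2 * m)))
      (fun q => F (fst (fst q))).
Proof.
apply sumz_bij with
  (g := fun q => let '((d, e), (d', e')) := q in ((d - d', e), (d', e + e')))
  (h := fun q => let '((u, e), (x, v)) := q in ((u + x, e), (x, v - e)));
quad; unfold Q, m.
- intros [[d e] [d' e']].
  rewrite !filter_In, in_odd_quadruples, in_mixed_quadruples, !Z.ltb_lt.
  cbn [fst snd]; intros H; repeat split; try lia; try div_lia; repeat f_equal; div_lia.
- intros [[u e] [x v]].
  rewrite !filter_In, in_odd_quadruples, in_mixed_quadruples, !Z.ltb_lt.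
  cbn [fst snd]; intros H; repeat split; try lia; try div_lia; repeat f_equal; div_lia.
Qed.

(** d e + d' e' = (d + d') e' + d (e - e'). *)
Lemma sum_sum_positive :
  sumz (filter (fun q => 0 <? snd (fst q) - snd (snd q)) Q)
    (fun q => F (fst (fst q) + fst (snd q)))
  = sumz (filter (fun q => fst (snd q) <? fst (fst q)) (mixed_quadruples (2 * m)))
      (fun q => F (fst (fst q))).
Proof.
apply sumz_bij with
  (g := fun q => let '((d, e), (d', e')) := q in ((d + d', e'), (d, e - e')))
  (h := fun q => let '((u, e), (x, v)) := q in ((x, e + v), (u - x, e)));
quad; unfold Q, m.
- intros [[d e] [d' e']].
  rewrite !filter_In, in_odd_quadruples, in_mixed_quadruples, !Z.ltb_lt.
  cbn [fst snd]; intros H; repeat split; try lia; try div_lia; repeat f_equal; div_lia.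
- intros [[u e] [x v]].
  rewrite !filter_In, in_odd_quadruples, in_mixed_quadruples, !Z.ltb_lt.
  cbn [fst snd]; intros H; repeat split; try lia; try div_lia; repeat f_equal; div_lia.
Qed.

(** Both sides are complements in the same sum; the complements e >= v and x >= u are
    exchanged by subtracting v from e and adding u to x, which preserves
    u e + x v.  Equality e = v or x = u is impossible by parity. *)
Lemma sum_mixed_exchange :
  sumz (filter (fun q => snd (fst q) <? snd (snd q)) (mixed_quadruples (2 * m)))
      (fun q => F (fst (fst q)))
  = sumz (filter (fun q => fst (snd q) <? fst (fst q)) (mixed_quadruples (2 * m)))
      (fun q => F (fst (fst q))).
Proof.
assert (E := sumz_split (fun q => snd (fst q) <? snd (snd q))
  (mixed_quadruples (2 * m)) (fun q => F (fst (fst q)))).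
rewrite (sumz_split (fun q => fst (snd q) <? fst (fst q))) in E.
match type of E with ?a + ?b = ?c + ?d => assert (X : d = b); [|lia] end.
clear E; apply sumz_bij with
  (g := fun q => let '((u, e), (x, v)) := q in ((u, e - v), (x + u, v)))
  (h := fun q => let '((u, e), (x, v)) := q in ((u, e + v), (x - u, v))); quad;
intros [[u e] [x v]];
rewrite !filter_In, !in_mixed_quadruples, !Bool.negb_true_iff, !Z.ltb_ge;
cbn [fst snd]; intros H; repeat split; try lia; try div_lia; repeat f_equal; div_lia.
Qed.

(** By symmetry each sum is its diagonal part plus twice the part above the diagonal.
    The parts above the diagonal cancel by [sum_mixed_exchange], so only the
    diagonals d = d' and e = e' remain. *)
Lemma liouville_identity :
  sumz Q (fun q => F (fst (fst q) - fst (snd q)) - F (fst (fst q) + fst (snd q)))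
  = sumz (odd_cofactor m) (fun p => fst p * (F 0 - F (2 * fst p))).
Proof.
rewrite sumz_sub.
rewrite (sumz_trichotomy (fun q => fst (fst q) - fst (snd q)) Q
  (fun q => F (fst (fst q) - fst (snd q)))).
rewrite (sumz_trichotomy (fun q => snd (fst q) - snd (snd q)) Q
  (fun q => F (fst (fst q) + fst (snd q)))).
rewrite (sumz_bij (filter (fun q => fst (fst q) - fst (snd q) <? 0) Q)
  (filter (fun q => 0 <? fst (fst q) - fst (snd q)) Q)
  _ (fun q => F (fst (fst q) - fst (snd q)))
  (fun q => (snd q, fst q)) (fun q => (snd q, fst q))).
rewrite (sumz_bij (filter (fun q => snd (fst q) - snd (snd q) <? 0) Q)
  (filter (fun q => 0 <? snd (fst q) - snd (snd q)) Q)
  _ (fun q => F (fst (fst q) + fst (snd q)))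
  (fun q => (snd q, fst q)) (fun q => (snd q, fst q))).
2-3, 6-7: quad.
2-5: unfold Q; intros [[d e] [d' e']]; cbn [fst snd];
  rewrite !filter_In, !in_odd_quadruples, !Z.ltb_lt; cbn [fst snd];
  intros H; repeat split; try lia; try div_lia.
- rewrite sum_difference_diagonal, sum_sum_diagonal, sum_difference_positive,
    sum_sum_positive, sum_mixed_exchange.
  fold m; rewrite (sumz_ext (odd_cofactor m) (fun p => fst p * (F 0 - F (2 * fst p)))
    (fun p => fst p * F 0 - fst p * F (2 * fst p))) by (intros; ring).
  rewrite sumz_sub; ring.
- f_equal; ring.
- rewrite <- F_even; f_equal; ring.
Qed.

End Liouville.

(** * Consequences for divisor sums *)

(** (d - d')^2 - (d + d')^2 = -4 d d'. *)
Lemma sum_product_odd_quadruples n :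
  sumz (odd_quadruples n) (fun q => fst (fst q) * fst (snd q))
  = sumz (odd_cofactor (Z.of_nat n + 1)) (fun p => fst p ^ 3).
Proof.
assert (H := liouville_identity n (fun x => x * x) (fun x => Z.mul_opp_opp x x)).
cbv beta in H.
rewrite (sumz_ext (odd_quadruples n) _ (fun q => -4 * (fst (fst q) * fst (snd q)))),
  (sumz_ext (odd_cofactor _) _ (fun p => -4 * fst p ^ 3)), !sumz_mul in H
  by (intros; ring).
lia.
Qed.

Lemma chi_double_odd_succ x : x mod 2 = 1 -> chi (2 * x + 1) = -1.
Proof. intros H; destruct (chi_cases (2 * x + 1)); div_lia. Qed.

Lemma chi_polarisation d d' : d mod 2 = 1 -> d' mod 2 = 1 ->
  chi (d - d' + 1) - chi (d + d' + 1) = 2 * (chi d * chi d').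
Proof.
intros Hd Hd'.
destruct (chi_cases d) as [[C ->]|[[C ->]|[C _]]]; [| |lia];
(destruct (chi_cases d') as [[C' ->]|[[C' ->]|[C' _]]]; [| |lia]);
destruct (chi_cases (d - d' + 1)) as [[X ->]|[[X ->]|[X ->]]];
destruct (chi_cases (d + d' + 1)) as [[Y ->]|[[Y ->]|[Y ->]]];
(reflexivity || (exfalso; clear Hd Hd'; div_lia)).
Qed.

Lemma odd_factorisations n d e : n mod 2 = 1 ->
  In (d, e) (factorisations n) -> d mod 2 = 1 /\ e mod 2 = 1.
Proof.
intros Hn H; apply in_factorisations in H; destruct H as [_ [_ <-]].
now apply odd_mul.
Qed.

Lemma sumz_odd_cofactor_odd n f : n mod 2 = 1 ->
  sumz (odd_cofactor n) f = sumz (factorisations n) f.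
Proof.
intros Hn; unfold odd_cofactor; rewrite sumz_filter; apply sumz_ext.
intros [d e] H; cbn [snd].
now rewrite (proj2 (odd_factorisations n d e Hn H)).
Qed.

(** The function chi(x + 1) is cos(pi x / 2) for even x and vanishes for odd x, so
    it is even and the addition theorem for the cosine produces chi(d) chi(d'). *)
Lemma sum_chi_odd_quadruples n : Z.of_nat n mod 2 = 0 ->
  sumz (odd_quadruples n) (fun q => chi (fst (fst q)) * chi (fst (snd q)))
  = sumz (factorisations (Z.of_nat n + 1)) fst.
Proof.
intros Hn.
assert (H := liouville_identity n (fun x => chi (x + 1))).
(* All divisors of the odd number n + 1 have odd cofactors. *)
cbv beta in H; rewrite (sumz_odd_cofactor_odd (Z.of_nat n + 1)) in H by div_lia.
rewrite (sumz_ext (odd_quadruples n) _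
    (fun q => 2 * (chi (fst (fst q)) * chi (fst (snd q))))),
  (sumz_ext (factorisations _) _ (fun p => 2 * fst p)), !sumz_mul in H.
- apply Z.mul_reg_l with 2; [easy|]; apply H.
  intros x; destruct (chi_cases (x + 1)) as [[C ->]|[[C ->]|[C ->]]],
    (chi_cases (- x + 1)); div_lia.
- intros [d e] Hp; apply odd_factorisations in Hp; [|div_lia].
  cbn [fst]; rewrite (chi_double_odd_succ d) by easy; change (chi (0 + 1)) with 1; ring.
- intros [[d e] [d' e']] Hq; apply in_odd_quadruples in Hq; cbn [fst snd].
  apply chi_polarisation; apply Hq.
Qed.

Lemma chi_sum_swap n : chi_sum n = sumz (factorisations n) (fun p => chi (fst p)).
Proof. apply sumz_factorisations_swap. Qed.

(** chi(d) chi(e) = chi(n) = -1, so exchanging a divisor with its cofactor changes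
    the sign. *)
Lemma chi_sum_3_mod_4 n : n mod 4 = 3 -> chi_sum n = 0.
Proof.
intros Hn; apply sumz_odd with (g := fun p => (snd p, fst p)).
- apply NoDup_factorisations.
- intros [d e]; cbn [fst snd]; rewrite !in_factorisations; intros [Hd [He H]].
  repeat split; trivial; [lia|].
  assert (C := chi_mul d e); rewrite H in C; unfold chi at 1 in C.
  rewrite Hn in C; simpl in C.
  destruct (chi_cases d) as [[_ E]|[[_ E]|[_ E]]],
    (chi_cases e) as [[_ E']|[[_ E']|[_ E']]]; rewrite E, E' in *; lia.
Qed.

(** A divisor of 2n with odd cofactor is twice a divisor of n with the same
    cofactor. *)
Lemma sumz_odd_cofactor_double n f :
  sumz (odd_cofactor (2 * n)) f
  = sumz (odd_cofactor n) (fun p => f (2 * fst p, snd p)).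
Proof.
apply sumz_bij with (g := fun p => (fst p / 2, snd p))
  (h := fun p => (2 * fst p, snd p));
try apply NoDup_filter, NoDup_factorisations.
- intros [d e]; unfold odd_cofactor; cbn [fst snd].
  rewrite !filter_In, !in_factorisations, Z.eqb_eq; cbn [fst snd].
  intros [[Hd [He H]] P].
  assert (Ed : d = 2 * (d / 2)).
  { assert (A := odd_mul d e).
    assert (d mod 2 = 0 \/ d mod 2 = 1) as [X|X] by div_lia; [div_lia|].
    rewrite H in A; assert ((2 * n) mod 2 = 1) by (apply A; easy); div_lia. }
  rewrite <- Ed; repeat split; trivial; nia.
- intros [d e]; unfold odd_cofactor; cbn [fst snd].
  rewrite !filter_In, !in_factorisations, Z.eqb_eq; cbn [fst snd].
  intros [[Hd [He H]] P]; repeat split; trivial; try nia.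
  f_equal; div_lia.
Qed.

Lemma chi_even x : x mod 2 <> 1 -> chi x = 0.
Proof. intros H; destruct (chi_cases x); div_lia. Qed.

Lemma chi_sum_odd_cofactor n :
  chi_sum n = sumz (odd_cofactor n) (fun p => chi (snd p)).
Proof.
unfold chi_sum, odd_cofactor; rewrite sumz_filter; apply sumz_ext; intros p _.
destruct (Z.eqb_spec (snd p mod 2) 1); [easy|now apply chi_even].
Qed.

Lemma chi_sum_double n : chi_sum (2 * n) = chi_sum n.
Proof. now rewrite !chi_sum_odd_cofactor, sumz_odd_cofactor_double. Qed.

(** This is (-1)^(x-1) for positive x. *)
Definition sign (x : Z) : Z := if x mod 2 =? 1 then 1 else -1.

Lemma sumz_even_cofactor n f :
  sumz (filter (fun p => negb (snd p mod 2 =? 1)) (factorisations (2 * n))) f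
  = sumz (factorisations n) (fun p => f (fst p, 2 * snd p)).
Proof.
apply sumz_bij with (g := fun p => (fst p, snd p / 2))
  (h := fun p => (fst p, 2 * snd p));
try apply NoDup_factorisations;
try apply NoDup_filter, NoDup_factorisations; intros [d e]; cbn [fst snd].
- rewrite !filter_In, !in_factorisations, Bool.negb_true_iff, Z.eqb_neq.
  cbn [fst snd]; intros [[Hd [He H]] P].
  assert (Ee : e = 2 * (e / 2)) by div_lia.
  rewrite <- Ee; repeat split; trivial; nia.
- rewrite !filter_In, !in_factorisations, Bool.negb_true_iff, Z.eqb_neq.
  cbn [fst snd]; intros [Hd [He H]]; repeat split; trivial; try nia; [div_lia|].
  f_equal; div_lia.
Qed.

Definition alternating_power_sum (s n : Z) : Z :=
  sumz (factorisations n) (fun p => sign (fst p) * fst p ^ s).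

Definition cofactor_alternating_sum (n : Z) : Z :=
  sumz (factorisations n) (fun p => sign (snd p) * fst p).

Lemma sign_even x : sign (2 * x) = -1.
Proof. unfold sign; destruct (Z.eqb_spec ((2 * x) mod 2) 1); div_lia. Qed.

Lemma sum_cubes_odd_cofactor_double n :
  sumz (odd_cofactor (2 * n)) (fun p => fst p ^ 3)
  = 8 * sumz (odd_cofactor n) (fun p => fst p ^ 3).
Proof.
rewrite sumz_odd_cofactor_double, <- sumz_mul; apply sumz_ext; intros; cbn [fst]; ring.
Qed.

(** Divisors of 2n with even cofactor are the divisors of n; the other ones are even
    and contribute the negative cubes. *)
Lemma alternating_cubes_double n :
  alternating_power_sum 3 (2 * n)
  = alternating_power_sum 3 n - 8 * sumz (odd_cofactor n) (fun p => fst p ^ 3).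
Proof.
unfold alternating_power_sum.
rewrite (sumz_split (fun p => snd p mod 2 =? 1)), sumz_even_cofactor; cbn [fst].
fold (odd_cofactor (2 * n)); rewrite sumz_odd_cofactor_double; cbn [fst].
rewrite (sumz_ext (odd_cofactor n) _ (fun p => -8 * fst p ^ 3)), sumz_mul; [ring|].
intros; rewrite sign_even; ring.
Qed.

Lemma alternating_power_sum_odd s n : n mod 2 = 1 ->
  alternating_power_sum s n = sumz (factorisations n) (fun p => fst p ^ s).
Proof.
intros Hn; apply sumz_ext; intros [d e] H; cbn [fst]; unfold sign.
rewrite (proj1 (odd_factorisations n d e Hn H)); simpl Z.eqb; cbv iota; ring.
Qed.

Lemma cofactor_alternating_sum_odd n : n mod 2 = 1 ->
  cofactor_alternating_sum n = sumz (factorisations n) fst.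
Proof.
intros Hn; apply sumz_ext; intros [d e] H; cbn [fst snd]; unfold sign.
rewrite (proj2 (odd_factorisations n d e Hn H)); simpl Z.eqb; cbv iota; ring.
Qed.

(** The factorisations with even cofactor have to be subtracted twice from the sum of
    all divisors; since 2d runs through the even divisors as d runs through the
    divisors with even cofactor, this leaves the odd divisors. *)
Lemma cofactor_alternating_sum_odd_divisors n :
  cofactor_alternating_sum n = sumz (odd_cofactor n) snd.
Proof.
(* Even divisors, and twice the divisors with even cofactor. *)
set (f := fun p : Z * Z => if fst p mod 2 =? 1 then 0 else fst p).
set (g := fun p : Z * Z => if snd p mod 2 =? 1 then 0 else 2 * fst p).
assert (E : sumz (factorisations n) f = sumz (factorisations n) g).
{ unfold f, g.
  rewrite (sumz_ext _ (fun p => if fst p mod 2 =? 1 then 0 else fst p)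
    (fun p => if negb (fst p mod 2 =? 1) then fst p else 0)),
   (sumz_ext _ (fun p => if snd p mod 2 =? 1 then 0 else 2 * fst p)
    (fun p => if negb (snd p mod 2 =? 1) then 2 * fst p else 0))
    by (intros; now destruct (_ =? 1)).
  rewrite <- !sumz_filter.
  apply sumz_bij with (g := fun p => (fst p / 2, 2 * snd p))
    (h := fun p => (2 * fst p, snd p / 2));
  try apply NoDup_filter, NoDup_factorisations; intros [d e]; cbn [fst snd];
  rewrite !filter_In, !in_factorisations, !Bool.negb_true_iff, !Z.eqb_neq;
  cbn [fst snd]; intros [[Hd [He H]] P].
  - assert (Ed : d = 2 * (d / 2)) by div_lia.
    repeat split; try nia; [div_lia|f_equal; div_lia].
  - assert (Ee : e = 2 * (e / 2)) by div_lia.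
    repeat split; try nia; [div_lia|f_equal; div_lia]. }
transitivity (sumz (factorisations n) fst - sumz (factorisations n) g).
- rewrite <- sumz_sub; apply sumz_ext; intros p _; unfold sign, g.
  destruct (snd p mod 2 =? 1); ring.
- rewrite <- E, <- sumz_sub; unfold odd_cofactor; rewrite sumz_filter.
  rewrite (sumz_factorisations_swap n (fun p => if snd p mod 2 =? 1 then snd p else 0)).
  apply sumz_ext; intros p _; unfold f; cbn [fst snd].
  destruct (fst p mod 2 =? 1); ring.
Qed.

Lemma cofactor_alternating_sum_double n :
  cofactor_alternating_sum (2 * n) = cofactor_alternating_sum n.
Proof.
now rewrite !cofactor_alternating_sum_odd_divisors, sumz_odd_cofactor_double.
Qed.

(** * Power series expansions *)

Local Close Scope Z_scope.
Local Open Scope R_scope.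

Local Ltac real_ring := match goal with |- @eq _ ?a ?b => change (@eq R a b); ring end.

Lemma Rabs_pow2_lt_1 q : Rabs q < 1 -> Rabs (q ^ 2) < 1.
Proof.
intros H; rewrite <- RPow_abs; assert (H0 := Rabs_pos q); simpl; nra.
Qed.

Lemma expansion_ext f g a b :
  (forall q, Rabs q < 1 -> f q = g q) -> (forall n, a n = b n) ->
  is_expansion f a -> is_expansion g b.
Proof.
intros Hf Ha H q Hq; rewrite <- Hf by assumption.
apply (is_pseries_ext (V := R_NormedModule) a); [assumption|now apply H].
Qed.

Lemma expansion_plus f g a b : is_expansion f a -> is_expansion g b ->
  is_expansion (fun q => f q + g q) (fun n => a n + b n).
Proof.
intros Hf Hg q Hq.
exact (is_pseries_plus (V := R_NormedModule) a b q _ _ (Hf q Hq) (Hg q Hq)).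
Qed.

Lemma expansion_scal c f a : is_expansion f a ->
  is_expansion (fun q => c * f q) (fun n => c * a n).
Proof.
intros Hf q Hq.
exact (is_pseries_scal (V := R_NormedModule) c a q _ (Rmult_comm q c) (Hf q Hq)).
Qed.

Lemma expansion_mult f g a b : is_expansion f a -> is_expansion g b ->
  is_expansion (fun q => f q * g q) (PS_mult a b).
Proof.
intros Hf Hg q Hq; apply is_pseries_mult; auto.
- now apply (is_expansion_radius f).
- now apply (is_expansion_radius g).
Qed.

Lemma expansion_shift f a : is_expansion f a ->
  is_expansion (fun q => q * f q) (PS_incr_1 a).
Proof.
intros Hf q Hq; exact (is_pseries_incr_1 (V := R_NormedModule) a q _ (Hf q Hq)).
Qed.

Lemma expansion_reflect f a : is_expansion f a ->
  is_expansion (fun q => f (- q)) (fun n => (-1) ^ n * a n).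
Proof.
intros Hf q Hq; apply is_pseries_R.
apply (is_series_ext (fun n => a n * (- q) ^ n)).
- intros n; replace (- q) with (-1 * q) by ring; rewrite Rpow_mult_distr; real_ring.
- apply (proj1 (is_pseries_R a (- q) (f (- q)))), Hf; now rewrite Rabs_Ropp.
Qed.

Definition interleave (b c : nat -> R) (n : nat) : R :=
  if Nat.even n then b (Nat.div2 n) else c (Nat.div2 n).

Lemma interleave_even b c n : interleave b c (2 * n) = b n.
Proof. unfold interleave; now rewrite Nat.even_mul, Nat.div2_double. Qed.

Lemma interleave_odd b c n : interleave b c (2 * n + 1) = c n.
Proof.
unfold interleave; rewrite Nat.add_1_r, Nat.even_succ, Nat.odd_mul.
now rewrite Nat.div2_succ_double.
Qed.

Lemma interleave_cases (P : nat -> R -> Prop) b c :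
  (forall n, P (2 * n)%nat (b n)) -> (forall n, P (2 * n + 1)%nat (c n)) ->
  forall n, P n (interleave b c n).
Proof.
intros He Ho n; destruct (Nat.Even_or_Odd n) as [[k ->]|[k ->]].
- now rewrite interleave_even.
- now rewrite interleave_odd.
Qed.

Lemma expansion_interleave g h b c : is_expansion g b -> is_expansion h c ->
  is_expansion (fun q => g (q ^ 2) + q * h (q ^ 2)) (interleave b c).
Proof.
intros Hg Hh q Hq; apply is_pseries_odd_even.
- apply (is_pseries_ext (V := R_NormedModule) b);
    [intros; now rewrite interleave_even|now apply Hg, Rabs_pow2_lt_1].
- apply (is_pseries_ext (V := R_NormedModule) c);
    [intros; now rewrite interleave_odd|now apply Hh, Rabs_pow2_lt_1].
Qed.

Lemma expansion_square f a : is_expansion f a ->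
  is_expansion (fun q => f (q ^ 2)) (interleave a (fun _ => 0)).
Proof.
intros Hf; apply (expansion_ext (fun q => f (q ^ 2) + q * (0 * f (q ^ 2)))
  _ (interleave a (fun n => 0 * a n))).
- intros; ring.
- intros n; pattern n, (interleave a (fun _ => 0) n); apply interleave_cases;
  intros k; [apply interleave_even|rewrite interleave_odd; ring].
- apply (expansion_interleave f (fun q => 0 * f q)); [|apply expansion_scal];
  assumption.
Qed.

(** Uniqueness of expansions, applied to the even and the odd part.  Besides
    separating parities it transfers an identity known only at the squares q^2,
    hence only for nonnegative arguments, to the whole interval. *)
Lemma interleaved_unique g1 h1 g2 h2 :
  (exists b, is_expansion g1 b) -> (exists c, is_expansion h1 c) ->
  (exists b, is_expansion g2 b) -> (exists c, is_expansion h2 c) ->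
  (forall q, Rabs q < 1 ->
     g1 (q ^ 2) + q * h1 (q ^ 2) = g2 (q ^ 2) + q * h2 (q ^ 2)) ->
  forall q, Rabs q < 1 -> g1 q = g2 q /\ h1 q = h2 q.
Proof.
intros [b1 Hb1] [c1 Hc1] [b2 Hb2] [c2 Hc2] E q Hq.
assert (U : forall n, interleave b1 c1 n = interleave b2 c2 n).
{ intros n; apply (is_expansion_unique (fun q => g1 (q ^ 2) + q * h1 (q ^ 2))).
  - now apply expansion_interleave.
  - apply (expansion_ext (fun q => g2 (q ^ 2) + q * h2 (q ^ 2))
      _ (interleave b2 c2)); [|easy|now apply expansion_interleave].
    intros; symmetry; now apply E. }
split.
- rewrite <- (is_pseries_unique _ _ _ (Hb1 q Hq)), <- (is_pseries_unique _ _ _ (Hb2 q Hq)).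
  apply PSeries_ext; intros n.
  now rewrite <- (interleave_even b1 c1), U, interleave_even.
- rewrite <- (is_pseries_unique _ _ _ (Hc1 q Hq)), <- (is_pseries_unique _ _ _ (Hc2 q Hq)).
  apply PSeries_ext; intros n.
  now rewrite <- (interleave_odd b1 c1), U, interleave_odd.
Qed.

Lemma IZR_sumz_seq F n :
  sum_f_R0 (fun k => IZR (F k)) n = IZR (sumz (seq 0 (S n)) F).
Proof.
induction n as [|n IH].
- unfold sumz; simpl; f_equal; lia.
- rewrite seq_S, sumz_app, plus_IZR, <- IH; simpl; unfold sumz; simpl.
  now rewrite Z.add_0_r.
Qed.

Lemma expansion_convolution f g a b :
  is_expansion f (fun n => IZR (a n)) -> is_expansion g (fun n => IZR (b n)) ->
  is_expansion (fun q => f q * g q) (fun n => IZR (convolution a b n)).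
Proof.
intros Hf Hg; eapply expansion_ext; [reflexivity| |apply (expansion_mult _ _ _ _ Hf Hg)].
intros n; unfold PS_mult, convolution, antidiagonal; rewrite sumz_map, <- IZR_sumz_seq.
apply sum_eq; intros k _; simpl; now rewrite mult_IZR.
Qed.

(** * Identities between theta functions *)

Definition half_theta (q : R) : R := Series (fun n => q ^ (n * n)).

Lemma ex_series_lacunary (e : nat -> nat) q :
  (forall n, (n <= e n)%nat) -> Rabs q < 1 -> ex_series (fun n => q ^ e n).
Proof.
intros He Hq.
apply (ex_series_le (K := R_AbsRing) (V := R_CompleteNormedModule) _
         (fun k => Rabs q ^ k)).
- intros k; change (Rabs (q ^ e k) <= Rabs q ^ k); rewrite <- RPow_abs.
  specialize (He k); replace (e k) with (k + (e k - k))%nat by lia.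
  rewrite pow_add; assert (H0 := pow_le _ k (Rabs_pos q)).
  assert (H1 := pow_incr (Rabs q) 1 (e k - k) (conj (Rabs_pos q) (Rlt_le _ _ Hq))).
  rewrite pow1 in H1; nra.
- apply ex_series_geom; now rewrite Rabs_Rabsolu.
Qed.

Lemma phi_half_theta q : Rabs q < 1 -> phi q = 2 * half_theta q - 1.
Proof.
intros Hq; unfold phi, bilateral_Series.
rewrite (Series_ext _ (fun n => q ^ (n * n))) by (intros; f_equal; lia).
rewrite (Series_ext (fun n => q ^ Z.to_nat (- _ * - _)) (fun n => q ^ (S n * S n)))
  by (intros; f_equal; lia).
fold (half_theta q).
assert (E : half_theta q = 1 + Series (fun n => q ^ (S n * S n))); [|lra].
unfold half_theta; rewrite Series_incr_1; [easy|].
apply ex_series_lacunary; [intros; nia|assumption].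
Qed.

(** (2n)^2 = 4 n^2 and (2n + 1)^2 = 1 + 8 n (n + 1) / 2; the two halves are the even
    and odd parts of a power series evaluated at 1. *)
Lemma half_theta_dissection q : Rabs q < 1 ->
  half_theta q = half_theta ((q ^ 2) ^ 2) + q * psi (((q ^ 2) ^ 2) ^ 2).
Proof.
intros Hq.
assert (Hq4 : Rabs ((q ^ 2) ^ 2) < 1) by now apply Rabs_pow2_lt_1, Rabs_pow2_lt_1.
unfold half_theta, psi.
apply is_series_unique.
assert (H : is_pseries (fun n => q ^ (n * n)) 1
  (Series (fun n => ((q ^ 2) ^ 2) ^ (n * n)) +
   1 * (q * Series (fun n => (((q ^ 2) ^ 2) ^ 2) ^ (n * (n + 1) / 2))))).
{ apply is_pseries_odd_even; rewrite pow1; apply is_pseries_R.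
  - apply (is_series_ext (fun n => ((q ^ 2) ^ 2) ^ (n * n))).
    + intros n; rewrite pow1, Rmult_1_r, <- !pow_mult; f_equal; lia.
    + apply Series_correct, ex_series_lacunary; [intros; nia|assumption].
  - apply (is_series_ext (fun n => q * (((q ^ 2) ^ 2) ^ 2) ^ (n * (n + 1) / 2))).
    + intros n; rewrite pow1, Rmult_1_r, <- !pow_mult, tech_pow_Rmult; f_equal.
      assert (E : (2 * (n * (n + 1) / 2) = n * (n + 1))%nat); [|lia].
      symmetry; apply Nat.div_exact; [lia|].
      destruct (Nat.Even_or_Odd n) as [[k ->]|[k ->]].
      * rewrite <- Nat.mul_assoc, Nat.mul_comm; apply Nat.Div0.mod_mul.
      * replace ((2 * k + 1) * (2 * k + 1 + 1))%nat
          with ((2 * k + 1) * (k + 1) * 2)%nat by lia; apply Nat.Div0.mod_mul.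
    + apply (is_series_scal (V := R_NormedModule) q), Series_correct.
      apply ex_series_lacunary; [|now apply Rabs_pow2_lt_1].
      intros n; apply Nat.div_le_lower_bound; nia. }
apply is_pseries_R in H; rewrite Rmult_1_l in H.
revert H; apply is_series_ext; intros n; rewrite pow1; real_ring.
Qed.

Lemma phi_dissection q : Rabs q < 1 ->
  phi q = phi ((q ^ 2) ^ 2) + 2 * q * psi (((q ^ 2) ^ 2) ^ 2).
Proof.
intros Hq; rewrite !phi_half_theta, (half_theta_dissection q); trivial; [ring|].
now apply Rabs_pow2_lt_1, Rabs_pow2_lt_1.
Qed.

(** The partial sum of the power series up to q^K contains exactly the squares up to
    (sqrt K)^2, so it is a partial sum of the theta series. *)
Lemma expansion_phi : is_expansion phi (fun n => IZR (theta_coef n)).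
Proof.
intros q Hq; apply is_pseries_R; rewrite phi_half_theta by assumption.
set (u := fun n => q ^ (n * n)).
assert (SS : forall (v : nat -> R) n,
  @eq R (sum_n v (S n)) (sum_n v n + v (S n))).
{ intros v n; exact (@sum_Sn R_AbelianMonoid v n). }
assert (P : forall K, @eq R (2 * sum_n u (Nat.sqrt K) - 1)
    (sum_n (fun k => IZR (theta_coef k) * q ^ k) K)).
{ induction K as [|K IH].
  - change (Nat.sqrt 0) with 0%nat; rewrite !sum_O.
    change (@eq R (2 * 1 - 1) (1 * 1)); ring.
  - rewrite SS, <- IH.
    assert (B := Nat.sqrt_spec' K); assert (B' := Nat.sqrt_spec' (S K)).
    destruct (Nat.sqrt_succ_or K) as [E|E]; rewrite E in *.
    + rewrite SS; replace (S K) with (S (Nat.sqrt K) * S (Nat.sqrt K))%nat by nia.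
      rewrite theta_coef_square by lia; unfold u; ring.
    + unfold theta_coef; rewrite E.
      destruct (Nat.eqb_spec (S K) 0); [lia|].
      destruct (Nat.eqb_spec (Nat.sqrt K * Nat.sqrt K) (S K)); [nia|]; ring. }
change (is_lim_seq (sum_n (fun k => IZR (theta_coef k) * q ^ k))
  (2 * half_theta q - 1)).
apply (is_lim_seq_ext _ _ _ P).
apply is_lim_seq_minus'; [|apply is_lim_seq_const].
apply (is_lim_seq_scal_l _ 2 (half_theta q)).
apply (is_lim_seq_subseq (sum_n u)).
- intros Q [N HN]; exists (N * N)%nat; intros n Hn; apply HN.
  rewrite <- (Nat.sqrt_square N); now apply Nat.sqrt_le_mono.
- apply Series_correct, ex_series_lacunary; [intros; nia|assumption].
Qed.

Lemma r_2 n : r 2 n = IZR (two_squares n).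
Proof.
rewrite <- convolution_theta_coef.
apply (is_expansion_unique (fun q => phi q ^ 2) (r 2)
  (fun n => IZR (convolution theta_coef theta_coef n))); [apply r_spec|].
apply (expansion_ext (fun q => phi q * phi q) _
  (fun n => IZR (convolution theta_coef theta_coef n))); [intros; ring|easy|].
apply expansion_convolution; apply expansion_phi.
Qed.

(** The square of [phi_dissection], arranged by exponents: those divisible by 4,
    those congruent to 2 modulo 8, and the odd ones. *)
Lemma phi_square_dissection q : Rabs q < 1 ->
  phi q ^ 2
  = (phi ((q ^ 2) ^ 2) ^ 2 + q ^ 2 * (4 * psi (((q ^ 2) ^ 2) ^ 2) ^ 2))
    + q * (4 * (phi ((q ^ 2) ^ 2) * psi (((q ^ 2) ^ 2) ^ 2))).
Proof. intros Hq; rewrite (phi_dissection q) by assumption; ring. Qed.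

Lemma expansion_phi_psi_squares :
  is_expansion (fun q => phi (q ^ 2) ^ 2 + q * (4 * psi ((q ^ 2) ^ 2) ^ 2))
    (interleave (r 2) (fun n => 4 * interleave (delta 2) (fun _ => 0) n)).
Proof.
apply (expansion_interleave (fun q => phi q ^ 2) (fun q => 4 * psi (q ^ 2) ^ 2));
  [apply r_spec|].
apply expansion_scal, (expansion_square (fun q => psi q ^ 2)), delta_spec.
Qed.

Lemma expansion_phi_psi :
  exists c, is_expansion (fun q => 4 * (phi (q ^ 2) * psi ((q ^ 2) ^ 2))) c.
Proof.
destruct ex_expansion_phi as [a Ha], ex_expansion_psi as [b Hb].
eexists; apply expansion_scal, expansion_mult.
- apply expansion_square, Ha.
- apply (expansion_square (fun q => psi (q ^ 2))), expansion_square, Hb.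
Qed.

(** The exponents congruent to 2 modulo 8 in phi^2 come only from
    (2 q psi(q^8))^2, so 4 delta_2(n) = r_2(8n + 2) = 4 X(2 (4n + 1)). *)
Lemma delta_2 n : delta 2 n = IZR (chi_sum (4 * Z.of_nat n + 1)).
Proof.
destruct expansion_phi_psi as [c Hc].
assert (E := is_expansion_unique _ _ _ (2 * (2 * (2 * n) + 1))%nat (r_spec 2)
  (expansion_ext _ _ _ _ (fun q Hq => eq_sym (phi_square_dissection q Hq))
    (fun _ => eq_refl)
    (expansion_interleave _ _ _ _ expansion_phi_psi_squares Hc))).
rewrite interleave_even, interleave_odd, interleave_even, r_2 in E.
unfold two_squares in E; destruct (Nat.eqb_spec (2 * (2 * (2 * n) + 1)) 0); [lia|].
replace (Z.of_nat (2 * (2 * (2 * n) + 1))) with (2 * (4 * Z.of_nat n + 1))%Z in E by lia.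
rewrite chi_sum_double, mult_IZR in E; lra.
Qed.

(** Compared coefficientwise: X(2n) = X(n), X(4n + 1) = delta_2(n) and
    X(4n + 3) = 0. *)
Lemma phi_square q : Rabs q < 1 ->
  phi q ^ 2 = phi (q ^ 2) ^ 2 + q * (4 * psi ((q ^ 2) ^ 2) ^ 2).
Proof.
intros Hq; rewrite <- (is_pseries_unique _ _ _ (r_spec 2 q Hq)).
rewrite <- (is_pseries_unique _ _ _ (expansion_phi_psi_squares q Hq)).
apply PSeries_ext; apply (interleave_cases (fun n x => r 2 n = x)); intros n.
- rewrite !r_2; unfold two_squares.
  destruct (Nat.eqb_spec (2 * n) 0), (Nat.eqb_spec n 0); try lia; [easy|].
  rewrite Nat2Z.inj_mul; change (Z.of_nat 2) with 2%Z; now rewrite chi_sum_double.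
- rewrite r_2; unfold two_squares; destruct (Nat.eqb_spec (2 * n + 1) 0); [lia|].
  rewrite mult_IZR; f_equal; clear; revert n.
  apply (interleave_cases (fun n x => IZR (chi_sum (Z.of_nat (2 * n + 1))) = x));
  intros n.
  + rewrite delta_2; do 2 f_equal; lia.
  + rewrite chi_sum_3_mod_4; [easy|].
    replace (Z.of_nat (2 * (2 * n + 1) + 1)) with (3 + Z.of_nat n * 4)%Z by lia.
    apply Z_mod_plus_full.
Qed.

(** Two formulas for the odd part of phi^2 are available, from squaring
    [phi_dissection] and from [phi_square].  Equating them gives the identity at
    q^2. *)
Lemma phi_psi q : Rabs q < 1 -> phi q * psi (q ^ 2) = psi q ^ 2.
Proof.
destruct ex_expansion_phi as [a Ha], ex_expansion_psi as [b Hb].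
assert (H : forall q, Rabs q < 1 ->
  4 * (phi (q ^ 2) * psi ((q ^ 2) ^ 2)) = 4 * psi (q ^ 2) ^ 2).
{ intros t Ht.
  refine (proj2 (interleaved_unique
   (fun q => phi (q ^ 2) ^ 2 + q * (4 * psi ((q ^ 2) ^ 2) ^ 2))
   (fun q => 4 * (phi (q ^ 2) * psi ((q ^ 2) ^ 2)))
   (fun q => phi q ^ 2) (fun q => 4 * psi (q ^ 2) ^ 2) _ _ _ _ _ t Ht)).
  - eexists; apply expansion_phi_psi_squares.
  - apply expansion_phi_psi.
  - eexists; apply r_spec.
  - eexists; apply expansion_scal, (expansion_square (fun q => psi q ^ 2)), delta_spec.
  - intros x Hx; now rewrite <- phi_square_dissection, <- phi_square. }
intros Hq.
(* The identity at t = q^2 is an identity of even parts; 0 * phi is a zero odd part. *)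
refine (proj1 (interleaved_unique (fun q => phi q * psi (q ^ 2)) (fun q => 0 * phi q)
  (fun q => psi q ^ 2) (fun q => 0 * phi q) _ _ _ _ _ q Hq)).
- eexists; apply expansion_mult, expansion_square; eassumption.
- eexists; apply expansion_scal; eassumption.
- eexists; apply delta_spec.
- eexists; apply expansion_scal; eassumption.
- intros t Ht; specialize (H t Ht); lra.
Qed.

(** The square of [phi_square], with the cross term simplified by [phi_psi]. *)
Lemma phi_fourth q : Rabs q < 1 ->
  phi q ^ 4 = (phi (q ^ 2) ^ 4 + q ^ 2 * (16 * psi ((q ^ 2) ^ 2) ^ 4))
              + q * (8 * psi (q ^ 2) ^ 4).
Proof.
intros Hq; assert (E := phi_psi (q ^ 2) (Rabs_pow2_lt_1 q Hq)).
replace (phi q ^ 4) with ((phi q ^ 2) ^ 2) by ring.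
replace (psi (q ^ 2) ^ 4) with ((psi (q ^ 2) ^ 2) ^ 2) by ring.
rewrite <- E, phi_square by assumption; ring.
Qed.

(** From the dissections, phi(q) phi(-q) = phi(-q^2)^2; with [phi_square] at q and -q
    this gives phi(t)^4 = phi(-t)^4 + 16 t psi(t^2)^4 for t = q^2.  Multiplication by
    phi(t)^4 and [phi_psi] yield the claim at t.  A square
    t = q^2 is required because phi(t) enters through the root q of t. *)
Lemma phi_eighth_square q : Rabs q < 1 ->
  phi (q ^ 2) ^ 8
  = phi (- (q ^ 2) ^ 2) ^ 8 + 16 * (q ^ 2 * psi (q ^ 2) ^ 8).
Proof.
intros Hq; assert (Hq2 := Rabs_pow2_lt_1 q Hq).
assert (Hn : Rabs (- q) < 1) by now rewrite Rabs_Ropp.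
assert (Hn2 : Rabs (- q ^ 2) < 1) by now rewrite Rabs_Ropp.
assert (Sq : forall t, (- t) ^ 2 = t ^ 2) by (intros; ring).
(* Difference of squares in the dissections at q and -q, then phi_square at -q^2. *)
assert (A : forall q, Rabs q < 1 -> phi q * phi (- q) = phi (- q ^ 2) ^ 2).
{ clear; intros q Hq.
  assert (Sq : forall t, (- t) ^ 2 = t ^ 2) by (intros; ring).
  rewrite (phi_dissection q), (phi_dissection (- q)), (phi_square (- q ^ 2));
    try rewrite Rabs_Ropp; try apply Rabs_pow2_lt_1; trivial.
  rewrite !Sq; ring. }
assert (B := phi_square q Hq); assert (C := phi_square (- q) Hn).
rewrite Sq in C.
assert (D := A (q ^ 2) Hq2); assert (A1 := A q Hq).
assert (E := phi_psi (q ^ 2) Hq2).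
set (a := phi (q ^ 2)) in *; set (b := phi (- q ^ 2)) in *.
set (p := psi ((q ^ 2) ^ 2)) in *; set (s := psi (q ^ 2)) in *.
assert (F : a ^ 4 - 16 * (q ^ 2 * p ^ 4) = b ^ 4).
{ replace (b ^ 4) with ((b ^ 2) ^ 2) by ring; rewrite <- A1.
  rewrite Rpow_mult_distr, B, C; ring. }
replace (phi (- (q ^ 2) ^ 2) ^ 8) with ((phi (- (q ^ 2) ^ 2) ^ 2) ^ 4) by ring.
replace (s ^ 8) with ((s ^ 2) ^ 4) by ring.
rewrite <- D, <- E; replace ((a * b) ^ 4) with (a ^ 4 * b ^ 4) by ring.
rewrite <- F; ring.
Qed.

Lemma phi_eighth q : Rabs q < 1 ->
  phi q ^ 8 = phi (- q ^ 2) ^ 8 + 16 * (q * psi q ^ 8).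
Proof.
intros Hq.
refine (proj1 (interleaved_unique (fun q => phi q ^ 8) (fun q => 0 * phi q ^ 8)
  (fun q => phi (- q ^ 2) ^ 8 + 16 * (q * psi q ^ 8))
  (fun q => 0 * phi q ^ 8) _ _ _ _ _ q Hq)).
- eexists; apply r_spec.
- eexists; apply expansion_scal, r_spec.
- eexists; apply expansion_plus.
  + apply (expansion_square (fun q => phi (- q) ^ 8)).
    apply (expansion_reflect (fun q => phi q ^ 8)), r_spec.
  + apply expansion_scal, expansion_shift, delta_spec.
- eexists; apply expansion_scal, r_spec.
- intros t Ht; now rewrite phi_eighth_square.
Qed.

(** * Coefficients of the fourth and eighth powers *)

Lemma delta_double s a : (forall n, delta s n = IZR (a n)) ->
  forall n, delta (s + s) n = IZR (convolution a a n).
Proof.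
intros H n.
assert (E : is_expansion (fun q => psi q ^ s) (fun n => IZR (a n)))
  by (apply (expansion_ext (fun q => psi q ^ s) _ (delta s)); auto; apply delta_spec).
apply (is_expansion_unique (fun q => psi q ^ (s + s)) (delta (s + s))
  (fun n => IZR (convolution a a n))); [apply delta_spec|].
apply (expansion_ext (fun q => psi q ^ s * psi q ^ s) _
  (fun n => IZR (convolution a a n))); [intros; now rewrite pow_add|easy|].
now apply expansion_convolution.
Qed.

(** In a decomposition of 4n + 2 as a sum of two odd numbers, both are congruent to 1
    or both to 3 modulo 4, and X vanishes on the latter; so Liouville's identity,
    which ranges over all odd numbers, computes the convolution. *)
Lemma convolution_chi_sum n :
  convolution (fun k => chi_sum (4 * Z.of_nat k + 1))
              (fun k => chi_sum (4 * Z.of_nat k + 1)) n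
  = sumz (factorisations (2 * Z.of_nat n + 1)) fst.
Proof.
replace (2 * Z.of_nat n + 1)%Z with (Z.of_nat (2 * n) + 1)%Z by lia.
rewrite <- sum_chi_odd_quadruples by (rewrite Nat2Z.inj_mul; div_lia).
etransitivity;
  [|symmetry; apply (sumz_odd_quadruples (2 * n) (fun p => chi (fst p)))].
rewrite (sumz_split (fun p => Nat.even (fst p)) (antidiagonal (2 * n))).
rewrite (sumz_0 (filter (fun p => negb _) _)).
- rewrite Z.add_0_r; apply sumz_bij with
    (g := fun p => (2 * fst p, 2 * snd p)%nat)
    (h := fun p => (Nat.div2 (fst p), Nat.div2 (snd p))).
  + apply NoDup_antidiagonal.
  + apply NoDup_filter, NoDup_antidiagonal.
  + intros [i j]; cbn [fst snd]; rewrite filter_In, !in_antidiagonal; cbn [fst snd].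
    intros H; rewrite Nat.even_mul, !Nat.div2_double, !chi_sum_swap.
    repeat split; [lia|].
    f_equal; do 2 f_equal; lia.
  + intros [i j]; cbn [fst snd]; rewrite filter_In, !in_antidiagonal; cbn [fst snd].
    intros [H E]; apply Nat.even_spec in E; destruct E as [k ->].
    replace j with (2 * (n - k))%nat by lia.
    rewrite !Nat.div2_double; split; [lia|easy].
- intros [i j]; cbn [fst snd]; rewrite filter_In, in_antidiagonal; cbn [fst snd].
  intros [_ E]; apply Bool.negb_true_iff in E.
  rewrite <- chi_sum_swap, chi_sum_3_mod_4; [easy|].
  assert (O : Nat.Odd i) by (apply Nat.odd_spec; unfold Nat.odd; now rewrite E).
  destruct O as [k ->].
  replace (2 * Z.of_nat (2 * k + 1) + 1)%Z with (3 + Z.of_nat k * 4)%Z by lia.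
  apply Z_mod_plus_full.
Qed.

Lemma delta_4 n : delta 4 n = IZR (sumz (factorisations (2 * Z.of_nat n + 1)) fst).
Proof. rewrite (delta_double 2 _ delta_2); f_equal; apply convolution_chi_sum. Qed.

Lemma delta_8 n :
  delta 8 n = IZR (sumz (odd_cofactor (Z.of_nat n + 1)) (fun p => (fst p ^ 3)%Z)).
Proof.
rewrite (delta_double 4 _ delta_4); f_equal.
rewrite <- sum_product_odd_quadruples; symmetry; apply sumz_odd_quadruples.
Qed.

Lemma expansion_phi_fourth :
  is_expansion (fun q => phi q ^ 4)
    (interleave
      (fun k => r 4 k + PS_incr_1 (interleave (fun j => 16 * delta 4 j) (fun _ => 0)) k)
      (fun k => 8 * delta 4 k)).
Proof.
eapply expansion_ext;
  [intros q Hq; symmetry; now apply phi_fourth|intros n; reflexivity|].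
apply (expansion_interleave
  (fun q => phi q ^ 4 + q * (16 * psi (q ^ 2) ^ 4)) (fun q => 8 * psi q ^ 4)).
- apply (expansion_plus (fun q => phi q ^ 4)); [apply r_spec|].
  apply (expansion_shift (fun q => 16 * psi (q ^ 2) ^ 4)).
  apply (expansion_square (fun q => 16 * psi q ^ 4)), expansion_scal, delta_spec.
- apply expansion_scal, delta_spec.
Qed.

Lemma r_4_odd n : r 4 (2 * n + 1) = 8 * delta 4 n.
Proof.
rewrite (is_expansion_unique _ _ _ _ (r_spec 4) expansion_phi_fourth).
apply interleave_odd.
Qed.

Lemma r_4_double_odd n :
  r 4 (2 * (2 * n + 1)) = r 4 (2 * n + 1) + 16 * delta 4 n.
Proof.
rewrite (is_expansion_unique _ _ _ (2 * _)%nat (r_spec 4) expansion_phi_fourth).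
rewrite interleave_even; f_equal.
rewrite Nat.add_1_r; unfold PS_incr_1; apply interleave_even.
Qed.

Lemma r_4_double_even n : (1 <= n)%nat -> r 4 (2 * (2 * n)) = r 4 (2 * n).
Proof.
intros Hn; rewrite (is_expansion_unique _ _ _ (2 * (2 * n)) (r_spec 4) expansion_phi_fourth).
rewrite interleave_even; replace (2 * n)%nat with (S (2 * (n - 1) + 1)) by lia.
unfold PS_incr_1; rewrite interleave_odd; ring.
Qed.

Lemma r_4_odd_value n :
  r 4 (2 * n + 1) = 8 * IZR (cofactor_alternating_sum (Z.of_nat (2 * n + 1))).
Proof.
rewrite r_4_odd, delta_4; do 2 f_equal.
replace (Z.of_nat (2 * n + 1)) with (2 * Z.of_nat n + 1)%Z by lia.
symmetry; apply cofactor_alternating_sum_odd; div_lia.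
Qed.

(** For odd n this is 8 + 16 = 24 times the sum of divisors; for even n neither side
    changes when n is replaced by n / 2. *)
Lemma r_4_even_value n : (1 <= n)%nat ->
  r 4 (2 * n) = 24 * IZR (cofactor_alternating_sum (Z.of_nat n)).
Proof.
induction n as [n IH] using lt_wf_ind; intros Hn.
destruct (Nat.Even_or_Odd n) as [[k ->]|[k ->]].
- rewrite r_4_double_even, IH by lia.
  rewrite Nat2Z.inj_mul; change (Z.of_nat 2) with 2%Z.
  now rewrite cofactor_alternating_sum_double.
- rewrite r_4_double_odd.
  assert (E := r_4_odd k); assert (E' := r_4_odd_value k); lra.
Qed.

(** Coefficients in [phi_eighth]: the first term is a series in q^2 whose
    coefficients are those of phi^8 with alternating signs. *)
Lemma r_8_succ n :
  r 8 (S n) = interleave (fun k => (-1) ^ k * r 8 k) (fun _ => 0) (S n)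
              + 16 * delta 8 n.
Proof.
apply (is_expansion_unique (fun q => phi q ^ 8) (r 8) (fun m =>
  interleave (fun k => (-1) ^ k * r 8 k) (fun _ => 0) m + 16 * PS_incr_1 (delta 8) m));
  [apply r_spec|].
eapply expansion_ext;
  [intros q Hq; symmetry; now apply phi_eighth|intros m; reflexivity|].
apply expansion_plus.
- apply (expansion_square (fun q => phi (- q) ^ 8)).
  apply (expansion_reflect (fun q => phi q ^ 8)), r_spec.
- apply expansion_scal, (expansion_shift (fun q => psi q ^ 8)), delta_spec.
Qed.

Lemma pow_minus_1_odd k : (-1) ^ (2 * k + 1) = -1.
Proof. rewrite Nat.add_1_r; apply pow_1_odd. Qed.

(** For even n = 2k the recurrence reads r_8(2k) = (-1)^k r_8(k) + 16 E(2k), where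
    E(n) is the sum of the cubes of the divisors of n with odd cofactor; the
    induction hypothesis makes the first term -16 times the alternating sum at k,
    and E(2k) = 8 E(k). *)
Lemma r_8_value n : (1 <= n)%nat ->
  r 8 n = 16 * (-1) ^ (n - 1) * IZR (alternating_power_sum 3 (Z.of_nat n)).
Proof.
induction n as [n IH] using lt_wf_ind; intros Hn.
destruct (Nat.Even_or_Odd n) as [[k ->]|[k ->]].
- replace (2 * k)%nat with (S (2 * k - 1)) at 1 by lia.
  rewrite r_8_succ; replace (S (2 * k - 1)) with (2 * k)%nat by lia.
  rewrite interleave_even, (IH k), delta_8 by lia.
  replace (Z.of_nat (2 * k - 1) + 1)%Z with (2 * Z.of_nat k)%Z by lia.
  replace (Z.of_nat (2 * k)) with (2 * Z.of_nat k)%Z by lia.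
  rewrite alternating_cubes_double, sum_cubes_odd_cofactor_double, minus_IZR, mult_IZR.
  replace (2 * k - 1)%nat with (2 * (k - 1) + 1)%nat by lia.
  rewrite pow_minus_1_odd.
  replace ((-1) ^ k) with (- (-1) ^ (k - 1))
    by (replace k with (S (k - 1)) at 2 by lia; simpl; ring).
  assert (Sq : (-1) ^ (k - 1) * (-1) ^ (k - 1) = 1)
    by (rewrite <- pow_add; replace (k - 1 + (k - 1))%nat with (2 * (k - 1))%nat by lia;
        apply pow_1_even).
  set (s := (-1) ^ (k - 1)) in *.
  match goal with |- - s * (16 * s * ?a) + _ = _ =>
    replace (- s * (16 * s * a)) with (-16 * a * (s * s)) by ring end.
  rewrite Sq; ring.
- replace (2 * k + 1)%nat with (S (2 * k)) at 1 by lia; rewrite r_8_succ.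
  replace (S (2 * k)) with (2 * k + 1)%nat by lia; rewrite interleave_odd, delta_8.
  replace (2 * k + 1 - 1)%nat with (2 * k)%nat by lia; rewrite pow_1_even.
  replace (Z.of_nat (2 * k + 1)) with (Z.of_nat (2 * k) + 1)%Z by lia.
  rewrite sumz_odd_cofactor_odd, alternating_power_sum_odd by
    (rewrite Nat2Z.inj_mul; div_lia).
  ring.
Qed.

(** * The divisor functions as sums over factorisations *)

Lemma sum_divisors_factorisations f n :
  sum_divisors f n
  = sumz (factorisations (Z.of_nat n)) (fun p => f (Z.to_nat (fst p))).
Proof.
change (sumz (divisors n) f
  = sumz (factorisations (Z.of_nat n)) (fun p => f (Z.to_nat (fst p)))).
apply sumz_bij with (g := fun d => (Z.of_nat d, Z.of_nat (n / d)))
  (h := fun p => Z.to_nat (fst p)).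
- apply NoDup_filter, seq_NoDup.
- apply NoDup_factorisations.
- intros d; unfold divisors; rewrite filter_In, in_seq, Nat.eqb_eq, in_factorisations.
  intros [Hd E]; cbn [fst]; rewrite Nat2Z.id; repeat split; trivial; [lia| |].
  + assert (0 < n / d)%nat by (apply Nat.div_str_pos; lia); lia.
  + apply Nat.Div0.div_exact in E; lia.
- intros [d e]; unfold divisors.
  rewrite filter_In, in_seq, Nat.eqb_eq, in_factorisations; cbn [fst].
  intros [Hd [He H]].
  assert (E : n = (Z.to_nat e * Z.to_nat d)%nat) by nia.
  repeat split; [lia|nia| |].
  + rewrite E; apply Nat.Div0.mod_mul.
  + rewrite E, Nat.div_mul by lia; f_equal; lia.
Qed.

Lemma extend_by_0_integer f x z : (x == inject_Z z)%Q -> (0 < z)%Z ->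
  extend_by_0 f x = f (Z.to_nat z).
Proof.
intros E Hz; unfold extend_by_0; rewrite (Qred_complete _ _ E).
rewrite Qcanon.Qred_identity by (apply Z.gcd_1_r); simpl.
destruct (Z.ltb_spec 0 z); [easy|lia].
Qed.

Lemma extend_by_0_noninteger f x : (forall z, ~ (x == inject_Z z)%Q) ->
  extend_by_0 f x = 0%Z.
Proof.
intros H; unfold extend_by_0.
destruct (Pos.eqb_spec (Qden (Qred x)) 1) as [E|E]; [|easy].
elim (H (Qnum (Qred x))); rewrite <- (Qred_correct x) at 1.
destruct (Qred x) as [a b]; simpl in *; now subst.
Qed.

Lemma sign_pow d : (1 <= d)%Z -> ((-1) ^ Z.of_nat (Z.to_nat d - 1) = sign d)%Z.
Proof.
intros Hd; unfold sign; replace (Z.of_nat (Z.to_nat d - 1)) with (d - 1)%Z by lia.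
destruct (Z.eqb_spec (d mod 2) 1) as [E|E].
- replace (d - 1)%Z with (2 * (d / 2))%Z by div_lia.
  rewrite Z.pow_mul_r by div_lia; apply Z.pow_1_l; div_lia.
- replace (d - 1)%Z with (2 * ((d - 1) / 2) + 1)%Z by div_lia.
  rewrite Z.pow_add_r, Z.pow_mul_r by div_lia.
  change ((-1) ^ 2)%Z with 1%Z; rewrite Z.pow_1_l by div_lia; easy.
Qed.

Lemma sigma_tilde_integer s x z : (x == inject_Z z)%Q -> (0 < z)%Z ->
  sigma_tilde s x = alternating_power_sum (Z.of_nat s) z.
Proof.
intros E Hz; unfold sigma_tilde; rewrite (extend_by_0_integer _ _ _ E Hz).
rewrite sum_divisors_factorisations, Z2Nat.id by lia.
apply sumz_ext; intros [d e] H; apply in_factorisations in H; cbn [fst].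
now rewrite sign_pow, Z2Nat.id by lia.
Qed.

Lemma sigma_hat_integer x z : (x == inject_Z z)%Q -> (0 < z)%Z ->
  sigma_hat 1 x = cofactor_alternating_sum z.
Proof.
intros E Hz; unfold sigma_hat; rewrite (extend_by_0_integer _ _ _ E Hz).
rewrite sum_divisors_factorisations, Z2Nat.id by lia.
apply sumz_ext; intros [d e] H; apply in_factorisations in H; cbn [fst snd].
replace (Z.to_nat z / Z.to_nat d)%nat with (Z.to_nat e).
- rewrite sign_pow, Z2Nat.id by lia; f_equal; apply Z.pow_1_r.
- replace (Z.to_nat z) with (Z.to_nat e * Z.to_nat d)%nat by nia.
  symmetry; apply Nat.div_mul; lia.
Qed.

Open Scope R_scope.

Theorem theorem5p1 : forall n : nat, (1 <= n)%nat ->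
  let N : Q := inject_Z (Z.of_nat n) in
  r 4 n = 16 * IZR (sigma_hat 1 (N / 2)) + 8 * IZR (sigma_hat 1 N) /\
  delta 4 n = IZR (sigma_tilde 1 (2 * N + 1)) /\
  r 8 n = 16 * (-1) ^ (n - 1) * IZR (sigma_tilde 3 N) /\
  8 * delta 8 n
    = IZR (sigma_tilde 3 (N + 1)) - IZR (sigma_tilde 3 (2 * (N + 1))).
Proof.
intros n Hn x; set (z := Z.of_nat n).
rewrite (sigma_hat_integer x z), (sigma_tilde_integer 3 x z),
  (sigma_tilde_integer 1 (2 * x + 1) (2 * z + 1)),
  (sigma_tilde_integer 3 (x + 1) (z + 1)),
  (sigma_tilde_integer 3 (2 * (x + 1)) (2 * (z + 1))).
2-11: try easy; try (unfold z; lia); cbv [Qeq Qplus Qmult inject_Z Qnum Qden x]; lia.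
repeat split.
- destruct (Nat.Even_or_Odd n) as [[k E]|[k E]].
  + rewrite (sigma_hat_integer (x / 2) (Z.of_nat k)); [|unfold x; rewrite E|lia].
    * rewrite E, r_4_even_value by lia.
      replace z with (2 * Z.of_nat k)%Z by (unfold z; lia).
      rewrite cofactor_alternating_sum_double; ring.
    * cbv [Qeq Qdiv Qmult Qinv inject_Z Qnum Qden]; lia.
  + unfold sigma_hat at 1; rewrite extend_by_0_noninteger.
    * unfold z; rewrite E, r_4_odd_value; ring.
    * cbv [Qeq Qdiv Qmult Qinv inject_Z Qnum Qden x]; intros m; lia.
- rewrite delta_4, alternating_power_sum_odd by div_lia.
  f_equal; apply sumz_ext; intros p _; symmetry; apply Z.pow_1_r.
- now apply r_8_value.
- rewrite delta_8, <- minus_IZR, <- mult_IZR; f_equal.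
  change (Z.of_nat 3) with 3%Z; rewrite alternating_cubes_double; fold z; lia.
Qed.
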